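(* Let $U$ be an open connected subset of $\mathbb{C}^k$ which is bounded (or Kobayashi hyperbolic), and let $f:U\to\mathbb{C}^k$ be a holomorphic open map. Assume that every point of $\partial U$ has a plurisubharmonic barrier. Suppose $\mathcal{C}$ is an $f$-invariant set in $U$. Let $V$ be the non-empty interior of $\overline{\mathcal{C}}$, where the closure is taken with respect to $U$. Assume also that a connected component $W$ of $V$ contains a recurrent point $p_0$. Under these hypotheses, if $\overline{\mathcal{C}}$ is an invariant closed set with a dense orbit in it, or a countable union of closed invariant sets each one with a dense orbit, then the interior $V$ of $\overline{\mathcal{C}}$ does not contain recurrent points.
   Context: A point $q\in\partial U$ has a plurisubharmonic barrier if there exists a continuous plurisubharmonic function $\rho_q$ on $U$ such that $\rho_q<0$ on $U$ and $\lim_{p\to q}\rho_q(p)=0$. A set $E\subset U$ is invariant (or $f$-invariant) if $f(E)\subset E$; it has a dense orbit if there is $x\in E$ whose forward orbit $\{f^n(x)\}_{n\in\mathbb{N}}$ is dense in $E$, where $f^n$ denotes the $n$-th iterate of $f$. A point $p_0\in V$ is recurrent if, $W$ being the connected component of $V$ containing $p_0$, the set $\{f^{n_i}(p_0)\}_i$ is relatively compact in $W$ for some subsequence $n_i\to\infty$. *)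

(* Defs.v *)
From HB Require Import structures.
From mathcomp Require Import all_boot all_order all_algebra.
From mathcomp Require Import all_classical all_reals all_analysis.
From mathcomp Require Import complex.

Set Implicit Arguments.
Unset Strict Implicit.
Unset Printing Implicit Defensive.

Import Order.TTheory GRing.Theory Num.Theory numFieldNormedType.Exports.

Local Open Scope classical_set_scope.
Local Open Scope ring_scope.
Local Open Scope complex_scope.

(* R[i] as a constant of type numClosedFieldType: the topology and the norm
   that a numFieldType carries are not inferred on the bare type R[i]. C^k is
   then 'rV[Cplx R]_k; its norm is the sup norm. *)
Definition Cplx (R : realType) : numClosedFieldType := R[i].

Section dynamics.
Context {T : topologicalType}.
Implicit Types (U V E : set T) (f : T -> T).

(* Closures and closedness relative to U. *)
Definition closure_in U E : set T := closure E `&` U.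

Definition closed_in U E : Prop := E `<=` U /\ closure_in U E = E.

Definition components V : set (set T) :=
  [set connected_component V x | x in V].

Definition boundary U : set T := closure U `\` interior U.

Definition invariant_set f E : Prop := f @` E `<=` E.

Definition forward_orbit f x : set T := range (fun n => iter n f x).

(* The orbit lies in E as soon as E is invariant, which is assumed
   wherever this is used. *)
Definition has_dense_orbit f E : Prop :=
  exists2 x, E x & E `<=` closure (forward_orbit f x).

Definition closed_invariant_dense_orbit U f E : Prop :=
  [/\ closed_in U E, invariant_set f E & has_dense_orbit f E].

Definition relatively_compact_in V E : Prop :=
  compact (closure E) /\ closure E `<=` V.

Definition recurrent f V p : Prop :=
  V p /\
  exists n_ : nat -> nat, {homo n_ : i j / (i < j)%N} /\
    relatively_compact_in (connected_component V p)
      (range (fun i => iter (n_ i) f p)).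

Definition open_map_on U f : Prop :=
  forall O : set T, O `<=` U -> open O -> open (f @` O).

End dynamics.

Section complex_analysis.
Context {R : realType}.
Local Notation C := (Cplx R).

(* The Frechet differential of the library is linear over the scalar field,
   here C: on an open set U this is holomorphy. *)
Definition holomorphic_on (V W : normedModType C) (U : set V) (f : V -> W) :
    Prop :=
  forall z, U z -> differentiable f z.

Definition cis (t : R) : C := (cos t +i* sin t)%C.

(* Upper semicontinuity, and the sub-mean value inequality on every closed
   disc {a + z b : |z| <= 1} contained in U. *)
Definition plurisubharmonic k (U : set 'rV[C]_k) (u : 'rV[C]_k -> \bar R) :
    Prop :=
  [/\ forall a, U a -> (u a < +oo)%E,
      forall a (c : R), U a -> (u a < c%:E)%E ->
        \forall x \near a, U x -> (u x < c%:E)%E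
    & forall a b : 'rV[C]_k, (forall z : C, `|z| <= 1 -> U (a + z *: b)) ->
        ((2 * pi)%:E * u a <=
          \int[lebesgue_measure]_(t in `[0%R, (2 * pi)%R])
            u (a + cis t *: b)%R)%E].

Definition psh_barrier k (U : set 'rV[C]_k) (q : 'rV[C]_k)
    (rho : 'rV[C]_k -> R) : Prop :=
  [/\ {in U, continuous rho},
      plurisubharmonic U (EFin \o rho),
      forall p, U p -> rho p < 0
    & rho p @[p --> within U (nbhs q)] --> (0 : R)].

Definition has_psh_barrier k (U : set 'rV[C]_k) (q : 'rV[C]_k) : Prop :=
  exists rho : 'rV[C]_k -> R, psh_barrier U q rho.

Definition unit_disc : set C^o := [set z | `|z| < 1].

(* Poincare distance of the unit disc, for the metric 2|dz| / (1 - |z|^2). *)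
Definition poincare_dist (a b : C) : R :=
  let t := complex.Re `|(a - b) / (1 - b^*%C * a)| in ln ((1 + t) / (1 - t)).

Definition holomorphic_disc k (U : set 'rV[C]_k) (phi : C^o -> 'rV[C]_k) :
    Prop :=
  holomorphic_on unit_disc phi /\ phi @` unit_disc `<=` U.

(* kobayashi_chain U p q l: there is a chain of holomorphic discs in U
   from p to q, of total length l. *)
Inductive kobayashi_chain k (U : set 'rV[C]_k) :
    'rV[C]_k -> 'rV[C]_k -> R -> Prop :=
| chain_nil p : U p -> kobayashi_chain U p p 0
| chain_cons phi a b q l :
    holomorphic_disc U phi -> unit_disc a -> unit_disc b ->
    kobayashi_chain U (phi b) q l ->
    kobayashi_chain U (phi a) q (poincare_dist a b + l).

Definition kobayashi_dist k (U : set 'rV[C]_k) (p q : 'rV[C]_k) : \bar R :=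
  ereal_inf [set l%:E | l in kobayashi_chain U p q].

Definition kobayashi_hyperbolic k (U : set 'rV[C]_k) : Prop :=
  forall p q, U p -> U q -> p <> q -> (0 < kobayashi_dist U p q)%E.

End complex_analysis.

(* Main.v *)
(** A closed invariant set E with a dense orbit has empty interior. Otherwise,
    f being open, the interior V of E is invariant, and f does not increase the
    Kobayashi distance of V. This distance induces the topology of V, because U
    is hyperbolic, so density of one orbit in V forces density of all of them.
    A locally compact space in which all forward orbits are dense is compact,
    whereas a nonempty open subset of C^k is not. Baire's theorem reduces
    countable unions to this case. A bounded U is hyperbolic by the Cauchy
    estimate for the derivative, which is obtained from Goursat's theorem, since
    holomorphy is only pointwise complex differentiability. *)
Require Import Defs.
From HB Require Import structures.
From mathcomp Require Import all_boot all_order all_algebra.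
From mathcomp Require Import all_classical all_reals all_analysis.
From mathcomp Require Import complex.
From mathcomp Require Import ring lra.

Set Implicit Arguments.
Unset Strict Implicit.
Unset Printing Implicit Defensive.

Import Order.TTheory GRing.Theory Num.Theory numFieldNormedType.Exports.

Local Open Scope classical_set_scope.
Local Open Scope ring_scope.

(** Density spreads from one orbit to all because [f] is non-expanding: if [f^m x] is close to [y]
    and a later [f^n x] is close to [z], then [f^(n-m) y] is still close to [f^n x], hence to [z].
    The visit to [z] must come after the visit to [y], so every tail of the dense orbit has to be
    dense; this holds because [C^k] has no isolated point when [k > 0]. No infimum is handled there:
    chains of explicit length are reversed, concatenated, pushed forward inside [V], and only at the
    end read as chains in [U], where hyperbolicity applies. From complex analysis, only the bound
    [|h b - h 0| <= 4 M b] is needed for a function bounded by [M] on the disc. A factor of modulus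
    1 turns moduli into real parts, so real integrals suffice. *)

(** * Goursat's theorem for closed forms on rectangles *)

Section rectangle.
Context {R : realType}.
Implicit Types (g : R -> R) (P T : R -> R -> R) (a b c d s t : R).

Definition segment_integral g a b : R :=
  \int[lebesgue_measure]_(x in `[a, b]) g x.
Local Notation I := segment_integral.

Lemma segment_integrable g a b : {in `[a, b], continuous g} ->
  (@lebesgue_measure R).-integrable `[a, b] (EFin \o g).
Proof.
move=> cg; apply: continuous_compact_integrable; first exact: segment_compact.
by apply: continuous_in_subspaceT => x; rewrite inE; exact: cg.
Qed.

Lemma segment_integral_split g a m b : a <= m -> m <= b ->
  {in `[a, b], continuous g} -> I g a b = I g a m + I g m b.
Proof.
move=> am mb /segment_integrable ig.
have := @Rintegral_itvB R g (BLeft a) (BRight b) m ig.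
rewrite !bnd_simp => /(_ am mb) e.
rewrite /I -(Rintegral_itv_obnd_cbnd (r := m)); last first.
  apply: integrableS ig => //; apply: subset_itv; rewrite ?bnd_simp//.
by rewrite -e addrC subrK.
Qed.

Lemma segment_integral_cst a b c : a <= b -> I (cst c) a b = c * (b - a).
Proof.
rewrite /I => ab; rewrite Rintegral_cst//= lebesgue_measure_itv/= lte_fin.
by case: ltgtP ab => //= -> _; rewrite subrr.
Qed.

(** Serves to compare opposite sides of a rectangle: [c] is the increment predicted by the
    differential, [e] the error. *)
Lemma segment_integral_close g1 g2 a b c e : a <= b ->
  {in `[a, b], continuous g1} -> {in `[a, b], continuous g2} ->
  {in `[a, b], forall x, `|g1 x - g2 x - c| <= e} ->
  `|I g1 a b - I g2 a b - c * (b - a)| <= e * (b - a).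
Proof.
move=> ab c1 c2 h.
have i1 := segment_integrable c1; have i2 := segment_integrable c2.
have icst (r : R) : (@lebesgue_measure R).-integrable `[a, b] (EFin \o cst r).
  by apply: segment_integrable => x _; exact: cst_continuous.
have iB : (@lebesgue_measure R).-integrable `[a, b] (EFin \o (g1 \- g2)).
  by apply: segment_integrable => x xab; apply: (continuousB (c1 _ xab) (c2 _ xab)).
rewrite /I -RintegralB// ler_distl -mulrBl -mulrDl -!segment_integral_cst//.
apply/andP; split; apply: le_Rintegral => //.
- by move=> x /= /h; rewrite ler_distl => /andP[].
- by move=> x /= /h; rewrite ler_distl => /andP[].
Qed.

Lemma segment_integral_le g a b c : a <= b -> {in `[a, b], continuous g} ->
  {in `[a, b], forall x, g x <= c} -> I g a b <= c * (b - a).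
Proof.
move=> ab cg gc; rewrite -segment_integral_cst//; apply: le_Rintegral => //.
- exact: segment_integrable.
- by apply: segment_integrable => x _; exact: cst_continuous.
Qed.

Lemma segment_integral_ge g a b c : a <= b -> {in `[a, b], continuous g} ->
  {in `[a, b], forall x, c <= g x} -> c * (b - a) <= I g a b.
Proof.
move=> ab cg gc; rewrite -segment_integral_cst//; apply: le_Rintegral => //.
- by apply: segment_integrable => x _; exact: cst_continuous.
- exact: segment_integrable.
Qed.

(* Closedness of the form P ds + T dt at a point, for coefficients which are
   Frechet differentiable but need not be of class C^1: dP/dt = dT/ds = q. *)
Definition closed_form_at P T s0 t0 : Prop :=
  exists p1 p2 q : R, forall e, 0 < e -> exists2 d, 0 < d &
    forall s t, `|s - s0| + `|t - t0| < d ->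
    `|P s t - P s0 t0 - p1 * (s - s0) - q * (t - t0)|
       <= e * (`|s - s0| + `|t - t0|) /\
    `|T s t - T s0 t0 - q * (s - s0) - p2 * (t - t0)|
       <= e * (`|s - s0| + `|t - t0|).

Lemma continuous_of_expansion g x p : (exists2 d, 0 < d &
    forall y, `|y - x| < d -> `|g y - g x - p * (y - x)| <= `|y - x|) ->
  {for x, continuous g}.
Proof.
move=> [d d0 h]; apply/cvgrPdist_lt => e e0; apply/nbhs_normP.
have p1 : 0 < 1 + `|p| by rewrite ltr_wpDr.
exists (Num.min d (e / (1 + `|p|))); first by rewrite /= lt_min d0 divr_gt0.
move=> y /=; rewrite distrC lt_min => /andP[/h {}h].
rewrite ltr_pdivlMr// => hs; rewrite distrC (le_lt_trans _ hs)// mulrDr mulr1.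
rewrite -(subrK (p * (y - x)) (g y - g x)) (le_trans (ler_normD _ _))//.
by rewrite lerD// normrM mulrC.
Qed.

Lemma closed_form_continuous P T s0 t0 : closed_form_at P T s0 t0 ->
  {for s0, continuous (P^~ t0)} /\ {for t0, continuous (T s0)}.
Proof.
move=> [p1 [p2 [q h]]]; have [d d0 {}h] := h 1 ltr01; split.
  apply: (@continuous_of_expansion _ _ p1); exists d => // s sd.
  have := h s t0; rewrite !subrr normr0 !mulr0 addr0 !subr0 mul1r.
  by move=> /(_ sd)[].
apply: (@continuous_of_expansion _ _ p2); exists d => // t td.
have := h s0 t; rewrite !subrr normr0 !mulr0 add0r !subr0 mul1r.
by move=> /(_ td)[].
Qed.

(** The integral of [P ds + T dt] along the boundary of the rectangle, counterclockwise. *)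
Definition circulation P T a b c d : R :=
  I (T b) c d - I (T a) c d - (I (P^~ d) a b - I (P^~ c) a b).

(** A side shared by two quarters is traversed in both directions and cancels. *)
Lemma circulation_split P T a m b c l d :
  a <= m -> m <= b -> c <= l -> l <= d ->
  (forall s t, a <= s <= b -> c <= t <= d -> closed_form_at P T s t) ->
  circulation P T a b c d =
    circulation P T a m c l + circulation P T m b c l +
    circulation P T a m l d + circulation P T m b l d.
Proof.
move=> am mb cl ld h.
have ab := le_trans am mb; have cd := le_trans cl ld.
have cP t : c <= t <= d -> {in `[a, b], continuous (P^~ t)}.
  move=> ct s; rewrite in_itv/= => st.
  by have [] := closed_form_continuous (h s t st ct).
have cT s : a <= s <= b -> {in `[c, d], continuous (T s)}.
  move=> st t; rewrite in_itv/= => ct.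
  by have [] := closed_form_continuous (h s t st ct).
rewrite /circulation.
rewrite (segment_integral_split cl ld (cT b _)) ?ab ?lexx//.
rewrite (segment_integral_split cl ld (cT a _)) ?ab ?lexx//.
rewrite (segment_integral_split am mb (cP d _)) ?cd ?lexx//.
rewrite (segment_integral_split am mb (cP c _)) ?cd ?lexx//.
by ring.
Qed.

(** Both pairs of opposite sides contribute the main term [q * (b - a) * (d - c)], with opposite
    signs, by closedness. Only the errors remain. *)
Lemma circulation_small P T a b c d s0 t0 p1 p2 q e :
  a <= s0 <= b -> c <= t0 <= d -> 0 <= e ->
  (forall s t, a <= s <= b -> c <= t <= d -> closed_form_at P T s t) ->
  (forall s t, a <= s <= b -> c <= t <= d ->
    `|P s t - P s0 t0 - p1 * (s - s0) - q * (t - t0)|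
       <= e * (`|s - s0| + `|t - t0|) /\
    `|T s t - T s0 t0 - q * (s - s0) - p2 * (t - t0)|
       <= e * (`|s - s0| + `|t - t0|)) ->
  `|circulation P T a b c d| <= 2 * e * (b - a + (d - c)) ^+ 2.
Proof.
move=> /andP[as0 s0b] /andP[ct0 t0d] e0 h est.
have ab := le_trans as0 s0b; have cd := le_trans ct0 t0d.
have cP t : c <= t <= d -> {in `[a, b], continuous (P^~ t)}.
  move=> ct s; rewrite in_itv/= => st.
  by have [] := closed_form_continuous (h s t st ct).
have cT s : a <= s <= b -> {in `[c, d], continuous (T s)}.
  move=> st t; rewrite in_itv/= => ct.
  by have [] := closed_form_continuous (h s t st ct).
have dist s t : a <= s <= b -> c <= t <= d ->
    e * (`|s - s0| + `|t - t0|) <= e * (b - a + (d - c)).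
  move=> /andP[? ?] /andP[? ?]; rewrite ler_wpM2l// lerD//.
    by rewrite ler_distl; apply/andP; split; lra.
  by rewrite ler_distl; apply/andP; split; lra.
have aab : a <= a <= b by rewrite lexx.
have bab : a <= b <= b by rewrite lexx andbT.
have ccd : c <= c <= d by rewrite lexx.
have dcd : c <= d <= d by rewrite lexx andbT.
have HT : `|I (T b) c d - I (T a) c d - q * (b - a) * (d - c)|
    <= 2 * e * (b - a + (d - c)) * (d - c).
  apply: segment_integral_close => //; [exact: cT|exact: cT|].
  move=> t; rewrite in_itv/= => tcd.
  have [_ /ler_normlP[+ +]] := est b t bab tcd.
  have [_ /ler_normlP[+ +]] := est a t aab tcd.
  have := dist _ _ bab tcd; have := dist _ _ aab tcd.
  move=> *; apply/ler_normlP; split; lra.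
have HP : `|I (P^~ d) a b - I (P^~ c) a b - q * (d - c) * (b - a)|
    <= 2 * e * (b - a + (d - c)) * (b - a).
  apply: segment_integral_close => //; [exact: cP|exact: cP|].
  move=> s; rewrite in_itv/= => sab.
  have [/ler_normlP[+ +] _] := est s d sab dcd.
  have [/ler_normlP[+ +] _] := est s c sab ccd.
  have := dist _ _ sab dcd; have := dist _ _ sab ccd.
  move=> *; apply/ler_normlP; split; lra.
move: HT HP => /ler_normlP[HT1 HT2] /ler_normlP[HP1 HP2].
rewrite /circulation; apply/ler_normlP; split; nra.
Qed.

(* Bisection: a quarter of a rectangle carries at least a quarter of its
   circulation, while at a point of differentiability the circulation is
   negligible with respect to the area. *)
Lemma goursat P T a b c d : a <= b -> c <= d ->
  (forall s t, a <= s <= b -> c <= t <= d -> closed_form_at P T s t) ->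
  circulation P T a b c d = 0.
Proof.
move=> ab cd h; apply/eqP/negPn/negP; rewrite -normr_gt0.
set M := `|_|; move=> M0.
pose w n : R := (b - a) * 2^-1 ^+ n; pose v n : R := (d - c) * 2^-1 ^+ n.
have w0 n : 0 <= w n by rewrite mulr_ge0 ?subr_ge0// exprn_ge0.
have v0 n : 0 <= v n by rewrite mulr_ge0 ?subr_ge0// exprn_ge0.
have wS n : w n = w n.+1 + w n.+1 by rewrite /w exprS; field.
have vS n : v n = v n.+1 + v n.+1 by rewrite /v exprS; field.
pose ok n (p : R * R) := [/\ a <= p.1, p.1 + w n <= b, c <= p.2, p.2 + v n <= d
  & M * 4^-1 ^+ n <= `|circulation P T p.1 (p.1 + w n) p.2 (p.2 + v n)|].
pose inside n (p q : R * R) := [/\ p.1 <= q.1, q.1 + w n.+1 <= p.1 + w n,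
  p.2 <= q.2 & q.2 + v n.+1 <= p.2 + v n].
(* The implication stands under the existential so that [choice] yields a total function; 0 is the
   default value outside [ok]. *)
have step (np : nat * (R * R)) : exists q, ok np.1 np.2 ->
    ok np.1.+1 q /\ inside np.1 np.2 q.
  case: np => n [s t] /=; have [|nok] := pselect (ok n (s, t)); last by exists 0.
  rewrite /ok/= => -[as_ sb ct td].
  have wn := w0 n.+1; have vn := v0 n.+1; have wSn := wS n; have vSn := vS n.
  have hm s' t' : s <= s' <= s + w n -> t <= t' <= t + v n ->
      closed_form_at P T s' t'.
    by move=> /andP[? ?] /andP[? ?]; apply: h; apply/andP; split; lra.
  rewrite (@circulation_split _ _ _ (s + w n.+1) _ _ (t + v n.+1)) //; try lra.
  have -> : s + w n = s + w n.+1 + w n.+1 by rewrite wSn addrA.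
  have -> : t + v n = t + v n.+1 + v n.+1 by rewrite vSn addrA.
  set c1 := circulation _ _ _ _ _ _; set c2 := circulation _ _ _ _ _ _.
  set c3 := circulation _ _ _ _ _ _; set c4 := circulation _ _ _ _ _ _.
  have -> : M * 4^-1 ^+ n = 4 * (M * 4^-1 ^+ n.+1) by rewrite exprS; field.
  move=> big.
  have [h1|h1] := leP (M * 4^-1 ^+ n.+1) `|c1|.
    exists (s, t) => _.
    by split; split => //=; clear -as_ sb ct td wn vn wSn vSn; lra.
  have [h2|h2] := leP (M * 4^-1 ^+ n.+1) `|c2|.
    exists (s + w n.+1, t) => _.
    by split; split => //=; clear -as_ sb ct td wn vn wSn vSn; lra.
  have [h3|h3] := leP (M * 4^-1 ^+ n.+1) `|c3|.
    exists (s, t + v n.+1) => _.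
    by split; split => //=; clear -as_ sb ct td wn vn wSn vSn; lra.
  have [h4|h4] := leP (M * 4^-1 ^+ n.+1) `|c4|.
    exists (s + w n.+1, t + v n.+1) => _.
    by split; split => //=; clear -as_ sb ct td wn vn wSn vSn; lra.
  have := ler_normD (c1 + c2 + c3) c4; have := ler_normD (c1 + c2) c3.
  by have := ler_normD c1 c2; lra.
have [F HF] := choice step.
pose u := fix u n := if n is m.+1 then F (m, u m) else (a, c).
have uok n : ok n (u n).
  elim: n => [|n IH]; last by have [] := HF (n, u n) IH.
  by rewrite /ok/w/v !expr0 !mulr1 !subrKC; split.
have uin n : inside n (u n) (u n.+1) by have [] := HF (n, u n) (uok n).
have nest m n : (m <= n)%N -> [/\ (u m).1 <= (u n).1,
    (u n).1 + w n <= (u m).1 + w m, (u m).2 <= (u n).2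
    & (u n).2 + v n <= (u m).2 + v m].
  move=> /subnKC <-; elim: (n - m)%N => [|i [? ? ? ?]]; first by rewrite addn0.
  by have [? ? ? ?] := uin (m + i)%N; rewrite addnS; split; lra.
(* A left or lower end never exceeds a right or upper end, even of another rectangle; hence the
   suprema below lie in all rectangles. *)
have nest' m n : [/\ (u m).1 <= (u n).1 + w n & (u m).2 <= (u n).2 + v n].
  have [mn|/ltnW nm] := leqP m n.
    by have [? ? ? ?] := nest _ _ mn; have := w0 n; have := v0 n; split; lra.
  by have [? ? ? ?] := nest _ _ nm; have := w0 m; have := v0 m; split; lra.
pose s0 := sup (range (fun n => (u n).1)).
pose t0 := sup (range (fun n => (u n).2)).
have s0P n : (u n).1 <= s0 <= (u n).1 + w n.
  apply/andP; split.
    apply: ub_le_sup; last by exists n.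
    by exists ((u n).1 + w n) => _ [m _ <-]; have [] := nest' m n.
  apply: ge_sup; first by exists (u 0).1; exists 0%N.
  by move=> _ [m _ <-]; have [] := nest' m n.
have t0P n : (u n).2 <= t0 <= (u n).2 + v n.
  apply/andP; split.
    apply: ub_le_sup; last by exists n.
    by exists ((u n).2 + v n) => _ [m _ <-]; have [] := nest' m n.
  apply: ge_sup; first by exists (u 0).2; exists 0%N.
  by move=> _ [m _ <-]; have [] := nest' m n.
have s0ab : a <= s0 <= b.
  by have := s0P 0%N; rewrite /w expr0 mulr1 subrKC.
have t0cd : c <= t0 <= d.
  by have := t0P 0%N; rewrite /v expr0 mulr1 subrKC.
have [p1 [p2 [q hq]]] := h _ _ s0ab t0cd.
(* The summand 1 keeps [l] positive for a degenerate rectangle. With the error [M / (4 l^2)] the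
   circulation is at most [M 4^-n (l - 1)^2 / (2 l^2)], which is less than [M 4^-n]. *)
pose l := b - a + (d - c) + 1.
have l0 : 0 < l by rewrite /l; lra.
have e0 : 0 < M / (4 * l ^+ 2) by rewrite divr_gt0// mulr_gt0// exprn_gt0.
have [del del0 {}hq] := hq _ e0.
have [n hn] : exists n, l * 2^-1 ^+ n < del.
  have : (fun n => l * 2^-1 ^+ n) @ \oo --> (l * 0 : R).
    by apply: cvgMr; apply: cvg_expr; rewrite ger0_norm ?invr_ge0// invf_lt1 ?ltr1n.
  rewrite mulr0 => /cvgrPdist_lt/(_ _ del0)[N _ /(_ N (leqnn N))] /=.
  by rewrite sub0r normrN => /ltr_normlP[_ ?]; exists N.
have p2n : 0 < (2^-1 : R) ^+ n by rewrite exprn_gt0// invr_gt0.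
have wv : w n + v n < del.
  by apply: le_lt_trans hn; rewrite /w /v -mulrDl ler_wpM2r ?(ltW p2n)// /l; lra.
have [ua ub uc ud uM] := uok n.
have [s0n1 s0n2] := andP (s0P n); have [t0n1 t0n2] := andP (t0P n).
have : `|circulation P T (u n).1 ((u n).1 + w n) (u n).2 ((u n).2 + v n)|
    <= 2 * (M / (4 * l ^+ 2)) *
       ((u n).1 + w n - (u n).1 + ((u n).2 + v n - (u n).2)) ^+ 2.
  apply: (@circulation_small _ _ _ _ _ _ s0 t0 p1 p2 q) => //.
  - exact: ltW.
  - move=> s t /andP[s1 s2] /andP[t1 t2].
    by apply: h; apply/andP; split; clear -ua ub uc ud s1 s2 t1 t2; lra.
  - move=> s t /andP[s1 s2] /andP[t1 t2]; apply: hq; apply: le_lt_trans wv.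
    by rewrite lerD// ler_distl; apply/andP; split;
      clear -s1 s2 t1 t2 s0n1 s0n2 t0n1 t0n2; lra.
apply/negP; rewrite -ltNge (lt_le_trans _ uM)//.
have -> : (u n).1 + w n - (u n).1 + ((u n).2 + v n - (u n).2)
    = (l - 1) * 2^-1 ^+ n by rewrite /w /v /l; ring.
have -> : (4^-1 : R) ^+ n = (2^-1 ^+ n) ^+ 2.
  by rewrite -exprM mulnC exprM expr2 -invfM -natrM.
rewrite exprMn [ltLHS]mulrA ltr_pM2r ?exprn_gt0//.
have -> : 2 * (M / (4 * l ^+ 2)) * (l - 1) ^+ 2 = M * ((l - 1) ^+ 2 / (2 * l ^+ 2)).
  by field; rewrite gt_eqF.
rewrite -[ltRHS]mulr1 ltr_pM2l// ltr_pdivrMr ?mulr_gt0 ?exprn_gt0//.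
have : 0 <= l - 1 by rewrite /l; lra.
by nra.
Qed.

(** The horizontal sides cancel by periodicity, so [T a] and [T b] have the same integral over a
    period. *)
Lemma periodic_bounds P T a b L A B : a <= b -> 0 < L ->
  (forall s t, a <= s <= b -> 0 <= t <= L -> closed_form_at P T s t) ->
  (forall s, P s L = P s 0) ->
  (forall t, B <= T a t) -> (forall t, T b t <= A) -> B <= A.
Proof.
move=> ab L0 h PL TB TA; have /goursat := h; move=> /(_ ab (ltW L0)).
have cT s : a <= s <= b -> {in `[0, L], continuous (T s)}.
  move=> st t; rewrite in_itv/= => ct.
  by have [] := closed_form_continuous (h s t st ct).
rewrite /circulation (_ : P^~ L = P^~ 0); last exact/funext.
rewrite subrr subr0 => /eqP; rewrite subr_eq0 => /eqP e.
rewrite -(ler_pM2r (x := L - 0)) ?subr0//.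
have := @segment_integral_ge (T a) 0 L B (ltW L0) (cT a _) (fun x _ => TB x).
rewrite subr0 => /(_ _)/le_trans -> //; first by rewrite lexx ab.
rewrite -e.
have := @segment_integral_le (T b) 0 L A (ltW L0) (cT b _) (fun x _ => TA x).
by rewrite subr0 => -> //; rewrite lexx ab.
Qed.

End rectangle.

Local Open Scope complex_scope.

(** * Real scalars and real-valued norms in complex spaces *)

Section real_scalars.
Context {R : realType}.
Implicit Types x y : R.

Definition rC x : Cplx R := x%:C.

Lemma rCI : injective rC. Proof. exact: complexI. Qed.
Lemma rC0 : rC 0 = 0. Proof. by []. Qed.
Lemma rC1 : rC 1 = 1. Proof. by []. Qed.
Lemma rCD x y : rC (x + y) = rC x + rC y. Proof. exact: rmorphD. Qed.
Lemma rCB x y : rC (x - y) = rC x - rC y. Proof. exact: rmorphB. Qed.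
Lemma rCM x y : rC (x * y) = rC x * rC y. Proof. exact: rmorphM. Qed.
Lemma rCV x : rC x^-1 = (rC x)^-1. Proof. exact: fmorphV. Qed.
Lemma lerC x y : (rC x <= rC y) = (x <= y). Proof. exact: lecR. Qed.
Lemma ltrC x y : (rC x < rC y) = (x < y). Proof. exact: ltcR. Qed.

End real_scalars.

Section norm.
Context {R : realType} {V : normedZmodType (Cplx R)}.
Implicit Types x y : V.

(** The norm of a space over [Cplx R] takes its values in [Cplx R], which is only partially ordered;
    this version is valued in a totally ordered field. *)
Definition rnorm x : R := complex.Re `|x|.

Lemma rnormE x : `|x| = rC (rnorm x).
Proof. by rewrite /rC /rnorm RRe_real// ger0_real. Qed.

Lemma rnorm_ge0 x : 0 <= rnorm x.
Proof. by rewrite -lerC -rnormE normr_ge0. Qed.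

Lemma rnorm0 : rnorm 0 = 0.
Proof. by rewrite /rnorm normr0. Qed.

Lemma rnorm0_eq0 x : rnorm x = 0 -> x = 0.
Proof. by move=> e; apply/eqP; rewrite -normr_eq0 rnormE e. Qed.

Lemma rnormN x : rnorm (- x) = rnorm x.
Proof. by rewrite /rnorm normrN. Qed.

Lemma rdistC x y : rnorm (x - y) = rnorm (y - x).
Proof. by rewrite /rnorm distrC. Qed.

Lemma ler_rnormD x y : rnorm (x + y) <= rnorm x + rnorm y.
Proof. by rewrite -lerC rCD -!rnormE ler_normD. Qed.

Lemma ler_rdistD z x y : rnorm (x - y) <= rnorm (x - z) + rnorm (z - y).
Proof. by rewrite -lerC rCD -!rnormE ler_distD. Qed.

End norm.

Section complex_plane.
Context {R : realType}.
Local Notation C := (Cplx R).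
Implicit Types (z w : C) (s t : R).

Lemma rnormM z w : rnorm (z * w) = rnorm z * rnorm w.
Proof. by apply: rCI; rewrite rCM -!rnormE normrM. Qed.

Lemma rnormV z : rnorm z^-1 = (rnorm z)^-1.
Proof. by apply: rCI; rewrite rCV -!rnormE normfV. Qed.

Lemma rnorm_rC s : rnorm (rC s) = `|s|.
Proof. by rewrite /rnorm normc_def/= expr0n/= addr0 sqrtr_sqr. Qed.

Lemma rnorm_i : rnorm ('i : C) = 1.
Proof. by rewrite /rnorm normc_def/= expr0n/= add0r expr1n sqrtr1. Qed.

Lemma rnorm_cis t : rnorm (cis t) = 1.
Proof. by rewrite /rnorm normc_def/= cos2Dsin2 sqrtr1. Qed.

Lemma ler_Re z : `|complex.Re z| <= rnorm z.
Proof. by rewrite /rnorm normc_def/= -sqrtr_sqr ler_wsqrtr// lerDl sqr_ge0. Qed.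

Lemma ler_Im z : `|complex.Im z| <= rnorm z.
Proof. by rewrite /rnorm normc_def/= -sqrtr_sqr ler_wsqrtr// lerDr sqr_ge0. Qed.

Definition expands (h : C -> C) z0 (D : C) : Prop :=
  forall e : R, 0 < e -> exists2 d : R, 0 < d & forall z,
    rnorm (z - z0) < d -> rnorm (h z - h z0 - D * (z - z0)) <= e * rnorm (z - z0).

Lemma expands_differentiable (h : C^o -> C^o) z0 :
  differentiable h z0 -> exists D, expands h z0 D.
Proof.
move=> /derivable1_diffP; rewrite /derivable => /cvg_ex[/= D hD].
exists D => e e0.
move/cvgrPdist_le : hD => /(_ (rC e)); rewrite ltrC => /(_ e0).
move=> /nbhs_normP/= [d d0 hd]; exists (rnorm d).
  by rewrite -ltrC -rnormE normr_gt0 gt_eqF.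
move=> z zd; have [->|zz0] := eqVneq z z0.
  by rewrite !subrr mulr0 subr0 rnorm0 mulr0.
have nz : rnorm (z - z0) != 0.
  by apply: contra_neq zz0 => /rnorm0_eq0/subr0_eq.
have := hd (z - z0); rewrite /ball_/= sub0r normrN.
rewrite rnormE -(gtr0_norm d0) rnormE ltrC subr_eq0 => /(_ zd zz0).
rewrite rnormE lerC => hle.
rewrite -ler_pdivrMr; last by rewrite lt_def rnorm_ge0 andbT.
rewrite -rnormV -rnormM.
apply: le_trans hle; rewrite le_eqVlt; apply/orP; left; apply/eqP.
rewrite -rnormN; congr rnorm.
rewrite /GRing.scale/= mulr1 subrK; field.
by rewrite subr_eq0.
Qed.

End complex_plane.

(** * Cauchy's estimate and a Lipschitz bound on the unit disc *)

Section cauchy.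
Context {R : realType}.
Local Notation C := (Cplx R).
Implicit Types (z w : C) (s t : R).

(** Puts real derivatives in the form of [expands], which passes to real parts and is convenient for
    [expR], [cos] and [sin]. *)
Lemma is_derive_expansion (g : R -> R) (x dg : R) : is_derive x 1 g dg <->
  (forall e, 0 < e -> exists2 d, 0 < d & forall y, `|y - x| < d ->
    `|g y - g x - dg * (y - x)| <= e * `|y - x|).
Proof.
split=> [[gd gv] e e0|h].
  have : (fun h : R => h^-1 *: ((g \o shift x) (h *: 1) - g x)) @ 0^' --> dg.
    by rewrite -gv; exact: gd.
  move=> /cvgrPdist_le/(_ _ e0)/nbhs_normP/= [d d0 hd]; exists d => // y yd.
  have [->|yx] := eqVneq y x; first by rewrite !subrr mulr0 subr0 normr0 mulr0.
  have := hd (y - x); rewrite /ball_/= sub0r normrN subr_eq0 => /(_ yd yx).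
  rewrite -ler_pdivrMr ?normr_gt0 ?subr_eq0// => hle.
  rewrite -normfV -normrM; apply: le_trans hle.
  rewrite le_eqVlt; apply/orP; left; apply/eqP; rewrite -normrN; congr `|_|.
  rewrite /GRing.scale/= mulr1 subrK; field.
  by rewrite subr_eq0.
have H : (fun h : R => h^-1 *: ((g \o shift x) (h *: 1) - g x)) @ 0^' --> dg.
  apply/cvgrPdist_le => e /h[d d0 hd]; apply/nbhs_normP; exists d => //= y.
  rewrite /ball_/= sub0r normrN => yd y0.
  have := hd (y + x); rewrite addrK => /(_ yd) hle.
  rewrite distrC /GRing.scale/= mulr1.
  have -> : y^-1 * (g (y + x) - g x) - dg = (g (y + x) - g x - dg * y) / y.
    by field.
  by rewrite normrM normfV ler_pdivrMr ?normr_gt0.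
by split; [apply/cvg_ex; exists dg|exact: cvg_lim].
Qed.

(** Complex differentiability in [s + it]: the partial derivatives are [A] and ['i * A]. *)
Definition expands2 (F : R -> R -> C) s0 t0 (A : C) : Prop :=
  forall e : R, 0 < e -> exists2 d : R, 0 < d & forall s t,
    `|s - s0| + `|t - t0| < d ->
    rnorm (F s t - F s0 t0 - A * (rC (s - s0) + 'i * rC (t - t0)))
      <= e * (`|s - s0| + `|t - t0|).

Lemma ler_rnorm_pair s t : rnorm (rC s + 'i * rC t : C) <= `|s| + `|t|.
Proof.
by rewrite (le_trans (ler_rnormD _ _))// rnormM rnorm_i mul1r !rnorm_rC.
Qed.

Lemma expands2_comp (h : C -> C) (F : R -> R -> C) s0 t0 D A :
  expands h (F s0 t0) D -> expands2 F s0 t0 A ->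
  expands2 (fun s t => h (F s t)) s0 t0 (D * A).
Proof.
move=> hD hA e e0.
have A0 := rnorm_ge0 A; have D0 := rnorm_ge0 D.
have A1 : 0 < rnorm A + 1 by lra.
have D1 : 0 < rnorm D + 1 by lra.
(* Each of the errors of [h] and of [F] gets half of [e]; [e2 <= 1] bounds the increment of [F] by
   [rnorm A + 1] times that of [(s, t)]. *)
pose e1 := e / (2 * (rnorm A + 1)); pose e2 := Num.min 1 (e / (2 * (rnorm D + 1))).
have e10 : 0 < e1 by rewrite divr_gt0// mulr_gt0.
have e20 : 0 < e2 by rewrite lt_min ltr01 divr_gt0// mulr_gt0.
have [d1 d10 hd1] := hD _ e10; have [d2 d20 hd2] := hA _ e20.
exists (Num.min d2 (d1 / (rnorm A + 1))); first by rewrite lt_min d20 divr_gt0.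
move=> s t; set n := _ + _; rewrite lt_min ltr_pdivlMr// => /andP[nd2 nd1].
have n0 : 0 <= n by rewrite addr_ge0.
have := hd2 s t nd2; set v := (rC _ + _); rewrite -/n => h2.
have vn : rnorm v <= n by exact: ler_rnorm_pair.
have e2n : e2 * n <= n by rewrite ler_piMl// /e2 ge_min lexx.
have Avn : rnorm A * rnorm v <= rnorm A * n by rewrite ler_wpM2l.
have FF : rnorm (F s t - F s0 t0) <= n * (rnorm A + 1).
  rewrite -(subrK (A * v) (F s t - F s0 t0)) (le_trans (ler_rnormD _ _))//.
  by rewrite rnormM; lra.
have := hd1 (F s t) (le_lt_trans FF nd1) => h1.
have -> : h (F s t) - h (F s0 t0) - D * A * v =
  (h (F s t) - h (F s0 t0) - D * (F s t - F s0 t0)) +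
  D * (F s t - F s0 t0 - A * v) by ring.
rewrite (le_trans (ler_rnormD _ _))// rnormM.
have E1 : e1 * rnorm (F s t - F s0 t0) <= e / 2 * n.
  rewrite (le_trans (ler_wpM2l (ltW e10) FF))// /e1 le_eqVlt; apply/orP; left.
  by apply/eqP; field; rewrite gt_eqF.
have E2 : rnorm D * rnorm (F s t - F s0 t0 - A * v) <= e / 2 * n.
  rewrite (le_trans (ler_wpM2l D0 h2))// mulrA ler_wpM2r//.
  apply: (@le_trans _ _ ((rnorm D + 1) * e2)); first by rewrite ler_wpM2r ?ltW//; lra.
  rewrite mulrC -ler_pdivlMr// /e2 ge_min; apply/orP; right.
  by rewrite le_eqVlt; apply/orP; left; apply/eqP; field; rewrite gt_eqF.
by lra.
Qed.

(* The Cauchy-Riemann equations: Im F ds + Re F dt is closed. *)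
Lemma expands2_closed_form F s0 t0 A : expands2 F s0 t0 A ->
  closed_form_at (fun s t => complex.Im (F s t)) (fun s t => complex.Re (F s t))
    s0 t0.
Proof.
move=> hF; exists (complex.Im A), (- complex.Im A), (complex.Re A) => e e0.
have [d d0 {}hF] := hF e e0; exists d => // s t st.
have := hF s t st; set r := rnorm _ => hr; split; apply: le_trans hr.
  apply: le_trans (ler_Im _); rewrite le_eqVlt; apply/orP; left; apply/eqP.
  congr `|_|; case: (F s t) (F s0 t0) A {hF r} => [a b] [a' b'] [x y] /=.
  by ring.
apply: le_trans (ler_Re _); rewrite le_eqVlt; apply/orP; left; apply/eqP.
congr `|_|; case: (F s t) (F s0 t0) A {hF r} => [a b] [a' b'] [x y] /=.
by ring.
Qed.

Definition polar s t : C := rC (expR s) * cis t.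

Lemma cisD s t : cis (s + t) = cis s * cis t :> C.
Proof.
apply/eqP; rewrite eq_complex /= cosD sinD; apply/andP; split; apply/eqP; ring.
Qed.

Lemma polarD s t s' t' : polar (s + s') (t + t') = polar s t * polar s' t'.
Proof. by rewrite /polar expRD cisD rCM mulrACA. Qed.

Lemma rnorm_polar s t : rnorm (polar s t) = expR s.
Proof. by rewrite /polar rnormM rnorm_cis mulr1 rnorm_rC gtr0_norm ?expR_gt0. Qed.

Lemma polar_periodic s t : polar s (t + pi *+ 2) = polar s t.
Proof. by rewrite /polar /cis cosD2pi sinD2pi. Qed.

Lemma complexE_rC z : z = rC (complex.Re z) + 'i * rC (complex.Im z).
Proof. exact: complexE. Qed.

(** By the addition formula it suffices to expand at the origin, where the components are
    [e^x cos y] and [e^x sin y]. *)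
Lemma polar_expands s0 t0 : expands2 polar s0 t0 (polar s0 t0).
Proof.
move=> e e0; have E0 := expR_gt0 s0.
(* The errors of the two components add up to at most [e1 |x| + 5 e1 |y|], and are then multiplied
   by [|polar s0 t0| = expR s0]. *)
pose e1 := Num.min 1 (e / (5 * expR s0)).
have e10 : 0 < e1 by rewrite lt_min ltr01 divr_gt0// mulr_gt0.
have e11 : e1 <= 1 by rewrite ge_min lexx.
have [d1 d10 h1] := (is_derive_expansion _ _ _).1 (is_derive_expR (0 : R)) _ e10.
have [d2 d20 h2] := (is_derive_expansion _ _ _).1 (is_derive_cos (0 : R)) _ e10.
have [d3 d30 h3] := (is_derive_expansion _ _ _).1 (is_derive_sin (0 : R)) _ e10.
exists (Num.min (Num.min d1 d2) (Num.min d3 (e1 / 2))).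
  by rewrite !lt_min d10 d20 d30 divr_gt0.
move=> s t; set x := s - s0; set y := t - t0.
have -> : polar s t - polar s0 t0 - polar s0 t0 * (rC x + 'i * rC y)
    = polar s0 t0 * (polar x y - 1 - (rC x + 'i * rC y)).
  have -> : polar s t = polar s0 t0 * polar x y.
    by rewrite -polarD /x /y !subrKC.
  by ring.
rewrite !lt_min => /andP[/andP[n1 n2] /andP[n3 n4]].
have x0 := normr_ge0 x; have y0 := normr_ge0 y.
have := h1 x; have := h2 y; have := h3 y.
rewrite !(expR0, cos0, sin0, subr0, oppr0, mul0r, mul1r, addr0).
move=> /(_ _)/ler_normlP[|hs1 hs2]; first lra.
move=> /(_ _)/ler_normlP[|hc1 hc2]; first lra.
move=> /(_ _)/ler_normlP[|he1 he2]; first lra.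
rewrite rnormM rnorm_polar -ler_pdivlMl// mulrA.
have e1e : 5 * e1 <= (expR s0)^-1 * e.
  rewrite mulrC -ler_pdivlMr// ge_min; apply/orP; right.
  by rewrite le_eqVlt; apply/orP; left; apply/eqP; field; rewrite gt_eqF.
apply: (@le_trans _ _ (5 * e1 * (`|x| + `|y|))); last first.
  by rewrite ler_wpM2r// addr_ge0.
rewrite (complexE_rC (_ - _)) (le_trans (ler_rnorm_pair _ _))// /polar /cis /rC /=.
rewrite !(mul0r, mul1r, addr0, subr0, add0r, mulr0).
have e1x : e1 * `|x| <= `|x| by rewrite ler_piMl.
have ex : expR x <= 2 by move: (ler_norm x); lra.
have ex1 : `|expR x - 1| <= e1.
  have /ler_normlP[? ?] := lexx `|x|.
  by apply/ler_normlP; split; lra.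
have ep := expR_gt0 x.
have t1 : `|expR x * (cos y - 1)| <= 2 * (e1 * `|y|).
  rewrite normrM (gtr0_norm ep); apply: ler_pM => //.
  by apply/ler_normlP; split.
have t2 : `|expR x * (sin y - y)| <= 2 * (e1 * `|y|).
  rewrite normrM (gtr0_norm ep); apply: ler_pM => //.
  by apply/ler_normlP; split.
have t3 : `|(expR x - 1) * y| <= e1 * `|y| by rewrite normrM ler_wpM2r.
move: t1 t2 t3 => /ler_normlP[? ?] /ler_normlP[? ?] /ler_normlP[? ?].
have l1 : `|expR x * cos y - 1 - x| <= 2 * (e1 * `|y|) + e1 * `|x|.
  by apply/ler_normlP; split; lra.
have l2 : `|expR x * sin y - y| <= 3 * (e1 * `|y|).
  by apply/ler_normlP; split; lra.
have := mulr_ge0 (ltW e10) x0; have := mulr_ge0 (ltW e10) y0.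
by lra.
Qed.

(** Makes a modulus the real part of a rotated number, so that real integrals and the mean value
    theorem can bound it. *)
Lemma unit_rotation (D : C) : exists2 k : C, rnorm k = 1 & k * D = rC (rnorm D).
Proof.
have [->|D0] := eqVneq D 0.
  by exists 1; rewrite ?mulr0 ?rnorm0// -rC1 rnorm_rC normr1.
have D0' : rnorm D != 0 by apply: contra_neq D0 => /rnorm0_eq0.
exists (rC (rnorm D) / D); last by rewrite divfK.
by rewrite rnormM rnorm_rC rnormV ger0_norm ?rnorm_ge0// mulfV.
Qed.

(* In the coordinates z = z0 + e^(s + it), the function (h z - h z0) / (z - z0)
   is 2 pi-periodic in t; by Goursat its mean over a circle centered at z0 does
   not depend on the radius, and it tends to D with the radius. Only the
   continuity of the quotient at z0 is used, not its differentiability. *)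
Lemma cauchy_estimate (h : C^o -> C^o) z0 (r M : R) D : 0 < r ->
  (forall z, rnorm (z - z0) <= r -> differentiable h z) ->
  (forall z, rnorm (z - z0) <= r -> rnorm (h z) <= M) ->
  expands h z0 D -> rnorm D <= 2 * M / r.
Proof.
move=> r0 dh hM hD.
have [k k1 kD] := unit_rotation D.
apply/ler_addgt0Pr => e e0; rewrite -lerBlDr.
have [d d0 {}hD] := hD e e0.
pose q : C^o -> C^o := fun z => k * ((h z - h z0) / (z - z0)).
(* Logarithm of the inner radius: [d / 2] because the expansion of [h] requires a distance strictly
   below [d], and the minimum so that [a <= ln r]. *)
pose a := ln (Num.min (d / 2) r).
have min0 : 0 < Num.min (d / 2) r by rewrite lt_min r0 divr_gt0.
have ea : expR a = Num.min (d / 2) r by rewrite lnK.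
have er : expR (ln r) = r by rewrite lnK.
pose F s t := q (z0 + polar s t).
have zF s t : z0 + polar s t - z0 = polar s t by rewrite addrC addKr.
have polar_neq0 s t : polar s t != 0 :> C.
  apply: contra_eq_neq (rnorm_polar s t) => ->.
  by rewrite rnorm0 eq_sym gt_eqF ?expR_gt0.
apply: (@periodic_bounds _ (fun s t => complex.Im (F s t))
  (fun s t => complex.Re (F s t)) a (ln r) (pi *+ 2)).
- by rewrite -ler_expR ea er ge_min lexx orbT.
- by rewrite pmulrn_rgt0// pi_gt0.
- move=> s t /andP[_ sr] _.
  have : differentiable q (z0 + polar s t).
    have dz : derivable (fun z : C^o => z - z0) (z0 + polar s t) 1.
      exact: (derivableB (@derivable_id _ _ _ _) (@derivable_cst _ _ _ (z0 : C^o) _ _)).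
    have dhz : derivable (fun z : C^o => h z - h z0) (z0 + polar s t) 1.
      have dhz : derivable h (z0 + polar s t) 1.
        by apply/derivable1_diffP/dh; rewrite zF rnorm_polar -er ler_expR.
      exact: (derivableB dhz (@derivable_cst _ _ _ (h z0 : C^o) _ _)).
    have dV : derivable (fun z : C^o => (z - z0)^-1) (z0 + polar s t) 1.
      by apply: (derivableV _ dz); rewrite zF.
    apply/derivable1_diffP.
    exact: (derivableM (@derivable_cst _ _ _ (k : C^o) _ _) (derivableM dhz dV)).
  move=> /expands_differentiable[D' hD'].
  apply: (@expands2_closed_form F).
  apply: (@expands2_comp q (fun s t => z0 + polar s t)); first exact: hD'.
  move=> e' /(polar_expands s t)[d' d'0 hd']; exists d' => // s' t' /hd' hs.
  rewrite opprD addrACA subrr add0r.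
  exact: hs.
- by move=> s; rewrite /F -[pi *+ 2]add0r polar_periodic.
- move=> t; set z := z0 + polar a t.
  have := hD z; rewrite zF rnorm_polar ea => /(_ _).
  have md : Num.min (d / 2) r < d by rewrite gt_min ltr_pdivrMr// ltr_pMr// ltr1n.
  move=> /(_ md); rewrite -ler_pdivrMr// -{1}ea -(rnorm_polar a t) -rnormV -rnormM.
  have -> : (h z - h z0 - D * polar a t) / polar a t = (h z - h z0) / polar a t - D.
    by field.
  rewrite -[rnorm _]mul1r -k1 -rnormM mulrBr kD => H.
  have := le_trans (ler_Re _) H => /ler_normlP[+ _].
  rewrite /F /q zF; case: (k * _) => x y /=.
  by lra.
(* On the outer circle the numerator [h z - h z0] is at most [2 M], whence the factor 2. *)
- move=> t; set z := z0 + polar (ln r) t.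
  apply: le_trans (le_trans (ler_norm _) (ler_Re _)) _.
  rewrite /F /q zF rnormM k1 mul1r rnormM rnormV rnorm_polar er.
  rewrite ler_pM2r ?invr_gt0//.
  have h1 : rnorm (h z) <= M by apply: hM; rewrite zF rnorm_polar er.
  have h2 : rnorm (h z0) <= M by apply: hM; rewrite subrr rnorm0 ltW.
  have := ler_rnormD (h z) (- h z0); rewrite rnormN; lra.
Qed.

(** If [b < 1/2], discs of radius [1/2] centred on [[0, b]] lie in the unit disc, so the derivative
    is at most [4 M] there and the mean value theorem applies to a real part. If [b >= 1/2], the
    trivial bound [2 M] is enough. *)
Lemma bounded_disc_lipschitz (h : C^o -> C^o) (M b : R) :
  (forall z, rnorm z < 1 -> differentiable h z) ->
  (forall z, rnorm z < 1 -> rnorm (h z) <= M) ->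
  0 <= b < 1 -> rnorm (h (rC b) - h 0) <= 4 * M * b.
Proof.
move=> dh hM /andP[b0 b1].
have M0 : 0 <= M by apply: le_trans (rnorm_ge0 _) (hM 0 _); rewrite rnorm0.
have hMM : rnorm (h (rC b) - h 0) <= 2 * M.
  have h1 : rnorm (h (rC b)) <= M by apply: hM; rewrite rnorm_rC ger0_norm.
  have h2 : rnorm (h 0) <= M by apply: hM; rewrite rnorm0.
  have := ler_rnormD (h (rC b)) (- h 0); rewrite rnormN; lra.
have [b2|b2] := leP 2^-1 b.
  by apply: le_trans hMM _; nra.
have [->|bn0] := eqVneq b 0; first by rewrite rC0 subrr rnorm0 mulr0.
have bgt0 : 0 < b by rewrite lt_def bn0.
have [k k1 kD] := unit_rotation (h (rC b) - h 0).
pose g (t : R) := complex.Re (k * h (rC t)).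
have dg t : exists D : R, t \in `[0, b] -> is_derive (t : R) 1 g D /\ D <= 4 * M.
  case tb : (t \in `[0, b]); last by exists 0.
  move: tb; rewrite in_itv/= => /andP[t0 tb].
  have nt : rnorm (rC t : C) < 2^-1.
    by rewrite rnorm_rC ger0_norm//; apply: le_lt_trans b2.
  have inD z : rnorm (z - rC t) <= 2^-1 -> rnorm z < 1.
    by move=> zt; have := ler_rnormD (z - rC t) (rC t); rewrite subrK; lra.
  have tt : rnorm (rC t - rC t : C) <= 2^-1 by rewrite subrr rnorm0 invr_ge0.
  have [D hD] := expands_differentiable (dh (rC t) (inD _ tt)).
  exists (complex.Re (k * D)) => _; split.
    apply/is_derive_expansion => e /hD[d d0 hd]; exists d => // y yt.
    have := hd (rC y); rewrite -rCB rnorm_rC => /(_ yt); apply: le_trans.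
    rewrite -[leRHS]mul1r -k1 -rnormM; apply: le_trans (ler_Re _).
    rewrite le_eqVlt; apply/orP; left; apply/eqP; congr `|_|.
    rewrite /g; case: k (h (rC y)) (h (rC t)) D {hD hd k1 kD g}.
    by move=> ? ? [? ?] [? ?] [? ?] /=; ring.
  apply: le_trans (le_trans (ler_norm _) (ler_Re _)) _; rewrite rnormM k1 mul1r.
  have half0 : 0 < 2^-1 :> R by rewrite invr_gt0.
  have := cauchy_estimate half0 (fun z hz => dh z (inD z hz))
    (fun z hz => hM z (inD z hz)) hD.
  by rewrite invrK; lra.
have [dg' Hdg] := choice dg.
have [||c cb] := @MVT R g dg' 0 b bgt0.
- by move=> x xb; have [|] := Hdg x => //; apply: subset_itv_oo_cc.
- apply: continuous_in_subspaceT => x; rewrite inE => /Hdg[gx _].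
  by apply/differentiable_continuous/derivable1_diffP; case: gx.
have [|_ cM] := Hdg c; first exact: subset_itv_oo_cc.
have -> : g b - g 0 = rnorm (h (rC b) - h 0).
  have := congr1 (@complex.Re R) kD; rewrite {2}/rC/= => <-.
  rewrite /g rC0; case: k (h (rC b)) (h 0) {g dg dg' Hdg cM k1 kD hMM}.
  move=> ? ? [? ?] [? ?] /=.
  by ring.
by rewrite subr0 => ->; rewrite ler_wpM2r.
Qed.

End cauchy.

(** * Compactness of balls and spheres in C^k *)

Section topology.
Context {R : realType}.
Local Notation C := (Cplx R).

Lemma nbhs_rnormP (V : normedModType C) (x : V) (A : set V) :
  nbhs x A <-> exists2 r : R, 0 < r & forall y, rnorm (y - x) < r -> A y.
Proof.
split=> [/nbhs_normP[e e0 eA]|[r r0 rA]].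
  exists (rnorm e); first by rewrite -ltrC -rnormE normr_gt0 gt_eqF.
  move=> y yx; apply: eA; rewrite /ball_/= distrC.
  by rewrite -(gtr0_norm e0) !rnormE ltrC.
apply/nbhs_normP; exists (rC r); first by rewrite /= ltrC.
by move=> y; rewrite /ball_/= distrC rnormE ltrC; exact: rA.
Qed.

Lemma closed_rball (V : normedModType C) (x : V) (r : R) :
  closed [set y | rnorm (y - x) <= r].
Proof.
rewrite -[X in closed X]setCK; apply: open_closedC; rewrite openE => y /= /negP.
rewrite -ltNge => ry; apply/nbhs_rnormP; exists (rnorm (y - x) - r).
  by rewrite subr_gt0.
move=> z zy /=; apply/negP; rewrite -ltNge.
by have := ler_rdistD z y x; rewrite (rdistC y z); lra.
Qed.

Lemma open_rball (V : normedModType C) (x : V) (r : R) :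
  open [set y | rnorm (y - x) < r].
Proof.
rewrite openE => y /= ry; apply/nbhs_rnormP; exists (r - rnorm (y - x)).
  by rewrite subr_gt0.
by move=> z zy /=; have := ler_rdistD y z x; lra.
Qed.

Lemma rC_continuous : continuous (@rC R).
Proof.
move=> x A /nbhs_rnormP[r r0 rA]; apply/nbhs_normP; exists r => // y.
rewrite /ball_/= distrC => yx; apply: rA.
by rewrite -rCB rnorm_rC.
Qed.

(** A disc is a closed part of the image of a square under [(s, t) |-> s + it]. *)
Lemma compact_disc (z : C) (r : R) : compact [set w : C | rnorm (w - z) <= r].
Proof.
pose f (p : R * R) : C := rC p.1 + 'i * rC p.2.
have cf : continuous f.
  move=> p; apply: cvgD.
    by apply: continuous_comp; [exact: cvg_fst|exact: rC_continuous].
  apply: cvgM.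
    exact: cst_continuous.
  by apply: continuous_comp; [exact: cvg_snd|exact: rC_continuous].
pose b := r + rnorm z.
have cb := @compact_setX _ _ _ _ (@segment_compact R (- b) b)
  (@segment_compact R (- b) b).
apply: subclosed_compact (continuous_compact _ cb) _.
- exact: (@closed_rball C^o z r).
- by apply: continuous_subspaceT => p; exact: cf.
move=> w /= wr; have wb : rnorm w <= b.
  by have := ler_rnormD (w - z) z; rewrite subrK /b; lra.
exists (complex.Re w, complex.Im w); last by rewrite /f/= -complexE_rC.
split => /=; rewrite in_itv/= -ler_norml; apply: le_trans wb.
  exact: ler_Re.
exact: ler_Im.
Qed.

Section row_vectors.
Context {k : nat}.
Implicit Types x y : 'rV[C]_k.

Lemma rnorm_coord x i : rnorm (x 0 i) <= rnorm x.
Proof.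
rewrite -lerC -!rnormE [leRHS]/Num.Def.normr/= mx_normE.
by rewrite -[leLHS]nngE num_le; exact: (le_bigmax _ _ (0, i)).
Qed.

Lemma rnorm_rV_le x (a : R) : 0 <= a -> (forall i, rnorm (x 0 i) <= a) ->
  rnorm x <= a.
Proof.
move=> a0 xa; rewrite -lerC -rnormE.
have -> : `|x| = mx_norm x by [].
have [->|/mx_norm_neq0[[i j] ->]] := eqVneq (mx_norm x) 0; first by rewrite -rC0 lerC.
by rewrite /= ord1 rnormE lerC.
Qed.

Lemma compact_rball x (r : R) : compact [set y : 'rV[C]_k | rnorm (y - x) <= r].
Proof.
have cB := @rV_compact C k (fun i => [set w | rnorm (w - x 0 i) <= r])
  (fun i => @compact_disc (x 0 i) r).
apply: subclosed_compact cB _; first exact: closed_rball.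
move=> y /= yx i; apply: le_trans yx.
by have := rnorm_coord (y - x) i; rewrite !mxE.
Qed.

Lemma compact_rsphere x (r : R) : compact [set y : 'rV[C]_k | rnorm (y - x) = r].
Proof.
apply: subclosed_compact (@compact_rball x r) _; last by move=> y /= ->.
have -> : [set y : 'rV[C]_k | rnorm (y - x) = r] =
    [set y | rnorm (y - x) <= r] `&` ~` [set y | rnorm (y - x) < r].
  apply/seteqP; split => [y /= ->|y /= [? /negP]]; first by rewrite ltxx lexx.
  by rewrite -leNgt => ?; apply/eqP; rewrite eq_le; apply/andP.
by apply: closedI; [exact: closed_rball|exact/open_closedC/open_rball].
Qed.

Lemma exists_rnorm (i : 'I_k) (r : R) : 0 <= r -> exists x, rnorm x = r.
Proof.
move=> r0; exists (\row_j (rC r : C)); apply/eqP; rewrite eq_le; apply/andP; split.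
  by apply: rnorm_rV_le => // j; rewrite mxE rnorm_rC ger0_norm.
by have := rnorm_coord (\row_j (rC r : C)) i; rewrite mxE rnorm_rC ger0_norm.
Qed.

End row_vectors.
End topology.

(** * Moebius maps and normalization of holomorphic discs *)

Section discs.
Context {R : realType} {k : nat}.
Local Notation C := (Cplx R).
Implicit Types (a b z w : C) (U V : set 'rV[C]_k) (p q : 'rV[C]_k).
Implicit Types (phi : C^o -> 'rV[C]_k).

Lemma rnorm_sqr z : rnorm z ^+ 2 = complex.Re z ^+ 2 + complex.Im z ^+ 2.
Proof. by rewrite /rnorm normc_def/= sqr_sqrtr// addr_ge0// sqr_ge0. Qed.

Lemma rnorm_conj z : rnorm (z^*%C : C) = rnorm z.
Proof. by rewrite /rnorm normcJ. Qed.

Lemma unit_discE z : unit_disc z = (rnorm z < 1) :> Prop.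
Proof. by rewrite /unit_disc/= rnormE -rC1 ltrC. Qed.

(** For [|a| < 1], the automorphism of the disc that sends 0 to [a], with inverse
    [moebius (- a)]. *)
Definition moebius a z : C := (z + a) / (1 + a^*%C * z).

Lemma moebius_denom a z : rnorm a < 1 -> rnorm z < 1 -> 1 + a^*%C * z != 0.
Proof.
move=> a1 z1; apply/eqP => e.
have : rnorm (a^*%C * z : C) = 1.
  have -> : a^*%C * z = - 1 :> C by apply/eqP; rewrite -addr_eq0 addrC e.
  by rewrite rnormN -rC1 rnorm_rC normr1.
by rewrite rnormM rnorm_conj; have := rnorm_ge0 a; have := rnorm_ge0 z; nra.
Qed.

(** Follows from [|1 + conj(a) z|^2 - |z + a|^2 = (1 - |a|^2) (1 - |z|^2)]. *)
Lemma rnorm_moebius a z : rnorm a < 1 -> rnorm z < 1 -> rnorm (moebius a z) < 1.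
Proof.
move=> a1 z1; have nz := moebius_denom a1 z1.
have dgt : 0 < rnorm (1 + a^*%C * z).
  by rewrite lt_def rnorm_ge0 andbT; apply: contra_neq nz => /rnorm0_eq0.
rewrite /moebius rnormM rnormV ltr_pdivrMr// mul1r.
rewrite -(@ltr_pXn2r _ 2) ?nnegrE ?rnorm_ge0// !rnorm_sqr.
have sq1 (w : C) : rnorm w < 1 -> complex.Re w ^+ 2 + complex.Im w ^+ 2 < 1.
  by move=> w1; rewrite -rnorm_sqr expr_lt1// rnorm_ge0.
have := sq1 _ a1; have := sq1 _ z1; case: a {a1 nz dgt} => x y; case: z {z1} => u v /=.
by nra.
Qed.

Lemma moebius_differentiable a z : rnorm a < 1 -> rnorm z < 1 ->
  differentiable (moebius a : C^o -> C^o) z.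
Proof.
move=> a1 z1.
have dn : derivable (fun z : C^o => (z + a : C^o)) z 1.
  exact: (derivableD (@derivable_id _ _ _ _) (@derivable_cst _ _ _ (a : C^o) _ _)).
have dd : derivable (fun z : C^o => (1 + a^*%C * z : C^o)) z 1.
  apply: (derivableD (@derivable_cst _ _ _ (1 : C^o) _ _)).
  exact: (derivableM (@derivable_cst _ _ _ (a^*%C : C^o) _ _) (@derivable_id _ _ _ _)).
have dV : derivable (fun z : C^o => ((1 + a^*%C * z)^-1 : C^o)) z 1.
  by apply: (derivableV _ dd); exact: moebius_denom.
apply/derivable1_diffP; exact: (derivableM dn dV).
Qed.

(** The Poincare distance between 0 and a point of modulus [t]. *)
Definition disc_length (t : R) : R := ln ((1 + t) / (1 - t)).

(** The right-hand side is [poincare_dist b a] unfolded, whence symmetry; its argument is the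
    modulus of [moebius (- a) b]. *)
Lemma poincare_distE a b :
  poincare_dist a b = disc_length (rnorm ((b - a) / (1 - a^*%C * b))).
Proof.
rewrite /poincare_dist /disc_length -/(rnorm _).
suff -> : rnorm ((a - b) / (1 - b^*%C * a)) = rnorm ((b - a) / (1 - a^*%C * b)) by [].
rewrite !rnormM !rnormV rdistC; congr (_ / _).
rewrite -[in RHS]rnorm_conj; congr rnorm.
case: a => ? ?; case: b => ? ?; apply/eqP; rewrite eq_complex/=.
by apply/andP; split; apply/eqP; ring.
Qed.

Lemma poincare_distC a b : poincare_dist a b = poincare_dist b a.
Proof. by rewrite [LHS]poincare_distE. Qed.

Lemma poincare_dist0 (t : R) : 0 <= t -> poincare_dist 0 (rC t) = disc_length t.
Proof.
move=> t0; rewrite poincare_distE subr0 (_ : 1 - _ = 1) ?divr1 ?rnorm_rC ?ger0_norm//.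
by rewrite conjc0 mul0r subr0.
Qed.

Lemma disc_length_ge (t : R) : 0 <= t < 1 -> t <= disc_length t.
Proof.
move=> /andP[t0 t1]; rewrite /disc_length -ler_expR lnK; last first.
  by rewrite posrE divr_gt0//; lra.
have := expR_ge1Dx (- t); rewrite expRN => h.
have e0 := expR_gt0 t.
rewrite ler_pdivlMr; last lra.
have : expR t * (1 - t) <= expR t * (expR t)^-1 by rewrite ler_pM2l.
by rewrite mulfV ?gt_eqF//; lra.
Qed.

Lemma disc_length_le (t : R) : 0 <= t -> t <= 2^-1 -> disc_length t <= 4 * t.
Proof.
move=> t0 t1; rewrite /disc_length.
have -> : (1 + t) / (1 - t) = 1 + 2 * t / (1 - t) by field; lra.
have p : 0 <= 2 * t / (1 - t) by rewrite divr_ge0//; lra.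
apply: le_trans (le_ln1Dx _) _; first lra.
by rewrite ler_pdivrMr; nra.
Qed.

Lemma disc_length_mono (s t : R) : 0 <= s -> s <= t -> t < 1 ->
  disc_length s <= disc_length t.
Proof.
move=> s0 st t1; rewrite /disc_length ler_ln ?posrE ?divr_gt0//; try lra.
rewrite ler_pdivrMr; last lra.
rewrite mulrAC ler_pdivlMr; last lra.
by nra.
Qed.

(** Precomposing [phi] with [moebius a] and a rotation moves the two parameters to 0 and to a point
    [t] of [[0, 1[], so that a chain can be studied on real segments. *)
Lemma disc_normalize U phi a b :
  holomorphic_disc U phi -> unit_disc a -> unit_disc b ->
  exists psi (t : R), [/\ holomorphic_disc U psi, 0 <= t < 1, psi 0 = phi a,
    psi (rC t) = phi b & poincare_dist a b = disc_length t].
Proof.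
move=> [hphi phiU]; rewrite !unit_discE => a1 b1.
pose bt : C := (b - a) / (1 - a^*%C * b).
have a1' : rnorm (- a) < 1 by rewrite rnormN.
have bt1 : rnorm bt < 1.
  have := rnorm_moebius a1' b1.
  by rewrite /moebius (_ : (- a)^*%C = - a^*%C :> C) ?mulNr// raddfN.
have [c c1 cb] := unit_rotation bt.
have c0 : c != 0 by apply: contra_eq_neq c1 => ->; rewrite rnorm0 eq_sym oner_eq0.
have cV1 : rnorm c^-1 = 1 by rewrite rnormV c1 invr1.
have inD z : rnorm z < 1 -> rnorm (c^-1 * z) < 1 by rewrite rnormM cV1 mul1r.
exists (fun z => phi (moebius a (c^-1 * z))), (rnorm bt); split.
- split=> [z|_ [z + <-]]; rewrite unit_discE => z1.
    apply: (@differentiable_comp _ _ _ _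
      (fun z : C^o => (moebius a (c^-1 * z) : C^o)) phi).
      apply: (@differentiable_comp _ _ _ _
        (fun z : C^o => (c^-1 * z : C^o)) (moebius a : C^o -> C^o)).
        apply/derivable1_diffP.
        exact: (derivableM (@derivable_cst _ _ _ (c^-1 : C^o) _ _)
          (@derivable_id _ _ _ _)).
      exact/moebius_differentiable/inD.
    by apply: hphi; rewrite unit_discE; exact/rnorm_moebius/inD.
  apply: phiU; exists (moebius a (c^-1 * z)) => //.
    by rewrite unit_discE; exact/rnorm_moebius/inD.
- by rewrite rnorm_ge0.
- by rewrite mulr0 /moebius mulr0 addr0 add0r divr1.
- rewrite -cb mulKf// /moebius; congr phi.
  have nz : 1 - a^*%C * b != 0 :> C.
    by have := moebius_denom a1' b1; rewrite (_ : (- a)^*%C = - a^*%C :> C) ?mulNr// raddfN.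
  have nz3 : 1 - a^*%C * a != 0 :> C.
    by have := moebius_denom a1' a1; rewrite (_ : (- a)^*%C = - a^*%C :> C) ?mulNr// raddfN.
  move: nz nz3; rewrite /bt; set e := (a^*%C : C) => nz nz3.
  field; rewrite nz/= (_ : _ + _ = 1 - e * a)//; ring.
- exact: poincare_distE.
Qed.

End discs.

(** * Chains of discs and Kobayashi hyperbolicity *)

Section chains.
Context {R : realType} {k : nat}.
Local Notation C := (Cplx R).
Implicit Types (U V : set 'rV[C]_k) (p q : 'rV[C]_k) (l : R).

Lemma chain_trans U p q w l m :
  kobayashi_chain U p q l -> kobayashi_chain U q w m ->
  kobayashi_chain U p w (l + m).
Proof.
elim=> [x Ux|phi a b x l' hphi a1 b1 _ IH] h; first by rewrite add0r.
by rewrite -addrA; apply: chain_cons => //; exact: IH.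
Qed.

Lemma chain_disc U phi a b : holomorphic_disc U phi -> unit_disc a ->
  unit_disc b -> kobayashi_chain U (phi a) (phi b) (poincare_dist a b).
Proof.
move=> hphi a1 b1; rewrite -[poincare_dist a b]addr0; apply: chain_cons => //.
by apply: chain_nil; apply: hphi.2; exists b.
Qed.

Lemma chain_sym U p q l : kobayashi_chain U p q l -> kobayashi_chain U q p l.
Proof.
elim=> [x Ux|phi a b x l' hphi a1 b1 _ IH]; first exact: chain_nil.
rewrite addrC poincare_distC; apply: chain_trans IH _.
exact: chain_disc.
Qed.

Lemma chain_ge0 U p q l : kobayashi_chain U p q l -> 0 <= l.
Proof.
elim=> // phi a b x l' hphi a1 b1 _ IH; rewrite addr_ge0//.
have [psi [t [_ t01 _ _ ->]]] := disc_normalize hphi a1 b1.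
by apply: le_trans (disc_length_ge t01); case/andP: t01.
Qed.

Lemma chain_map U V (f : 'rV[C]_k -> 'rV[C]_k) p q l :
  holomorphic_on U f -> f @` U `<=` V ->
  kobayashi_chain U p q l -> kobayashi_chain V (f p) (f q) l.
Proof.
move=> hf fUV; elim=> [x Ux|phi a b x l' [hphi phiU] a1 b1 _ IH].
  by apply: chain_nil; apply: fUV; exists x.
apply: (@chain_cons _ _ _ (f \o phi)) => //; split=> [z z1|_ [z z1 <-]].
  apply: differentiable_comp; first exact: hphi.
  by apply: hf; apply: phiU; exists z.
by apply: fUV; exists (phi z) => //; apply: phiU; exists z.
Qed.

Lemma chain_sub U V p q l : U `<=` V ->
  kobayashi_chain U p q l -> kobayashi_chain V p q l.
Proof.
move=> UV; elim=> [x Ux|phi a b x l' [hphi phiU] a1 b1 _ IH].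
  exact/chain_nil/UV.
by apply: chain_cons => //; split=> //; apply: subset_trans UV.
Qed.

(** In a ball of radius [r] inside [U], one affine disc centred at [p] reaches [q], at the parameter
    [t = |q - p| / r]. *)
Lemma chain_near U p (e : R) : open U -> U p -> 0 < e ->
  \forall q \near p, exists2 l, l < e & kobayashi_chain U p q l.
Proof.
move=> Uo Up e0.
have /nbhs_rnormP[r r0 rU] : nbhs p U by exact: open_nbhs_nbhs.
(* This gives [t < 1/2], where [disc_length_le] applies, and [4 t < e]. *)
apply/nbhs_rnormP; exists (r * Num.min 2^-1 (e / 4)).
  by rewrite mulr_gt0// lt_min invr_gt0 divr_gt0// ltr0n.
move=> q; rewrite -ltr_pdivrMl// mulrC lt_min; set n := rnorm _.
move=> /andP[t2 te].
have [n0|n0] := eqVneq n 0.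
  exists 0 => //; move: n0 => /rnorm0_eq0/subr0_eq ->; exact: chain_nil.
have ngt : 0 < n by rewrite lt_def n0 rnorm_ge0.
pose t := n / r; have t0 : 0 < t by rewrite divr_gt0.
pose v := rC t^-1 *: (q - p).
pose phi (z : C^o) := p + z *: v.
have hphi : holomorphic_disc U phi.
  split=> [z z1|_ [z + <-]].
    apply: differentiableD; first exact: differentiable_cst.
    by apply: differentiableZl; exact/derivable1_diffP/derivable_id.
  rewrite unit_discE => z1; apply: rU; rewrite /phi addrC addKr.
  apply: (@le_lt_trans _ _ (rnorm z * r)); last by rewrite -[ltRHS]mul1r ltr_pM2r.
  rewrite -lerC rCM -!rnormE normrZ ler_wpM2l// /v normrZ !rnormE -rCM lerC.
  by rewrite rnorm_rC gtr0_norm ?invr_gt0// /t invf_div divfK.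
have phi0 : phi 0 = p by rewrite /phi scale0r addr0.
have phit : phi (rC t) = q.
  rewrite /phi /v scalerA -rCM mulfV ?gt_eqF// rC1 scale1r addrC subrK//.
exists (poincare_dist 0 (rC t : C)).
  rewrite poincare_dist0 ?ltW//.
  by apply: le_lt_trans (disc_length_le (ltW t0) _) _; rewrite /t; lra.
rewrite -phi0 -phit; apply: chain_disc => //; rewrite unit_discE.
  by rewrite rnorm0.
by rewrite rnorm_rC gtr0_norm// /t; lra.
Qed.

(** The Lipschitz bound, applied to each coordinate of each normalized disc, shows that the ends of
    a chain of length [l] are at most [4 M l] apart. *)
Lemma bounded_kobayashi_hyperbolic U : bounded_set U -> kobayashi_hyperbolic U.
Proof.
move=> [M' [M'r bM']]; pose M := rnorm M' + 1.
have M0 : 0 < M by rewrite ltr_wpDl// rnorm_ge0.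
have bM x : U x -> rnorm x <= M.
  move=> Ux; rewrite -lerC -rnormE; apply: bM' Ux.
  rewrite /M rCD rC1 -rnormE ltr_pwDr//; exact: real_ler_norm.
have lip p q l : kobayashi_chain U p q l -> rnorm (p - q) <= 4 * M * l.
  elim=> [x Ux|phi a b x l' hphi a1 b1 _ IH]; first by rewrite subrr rnorm0 mulr0.
  rewrite mulrDr (le_trans (ler_rdistD (phi b) _ _))// lerD//.
  have [psi [t [[hpsi psiU] t01 <- <- ->]]] := disc_normalize hphi a1 b1.
  apply: (@le_trans _ _ (4 * M * t)); last first.
    by rewrite ler_wpM2l ?disc_length_ge// mulr_ge0// ltW.
  have [t0 t1] := andP t01.
  rewrite rdistC; apply: rnorm_rV_le => [|j]; first by rewrite !mulr_ge0// ltW.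
  rewrite !mxE.
  apply: (@bounded_disc_lipschitz _ (fun z : C^o => (psi z 0 j : C^o))) => // z z1.
    apply: (@differentiable_comp _ _ _ _ psi (fun x : 'rV[C]_k => (x 0 j : C^o))).
      by apply: hpsi; rewrite unit_discE.
    exact: differentiable_coord.
  apply: le_trans (rnorm_coord _ _) (bM _ _).
  by apply: psiU; exists z => //; rewrite unit_discE.
move=> p q Up Uq pq; have pq0 : 0 < rnorm (p - q).
  by rewrite lt_def rnorm_ge0 andbT; apply/eqP => /rnorm0_eq0/subr0_eq.
apply: (@lt_le_trans _ _ (rnorm (p - q) / (4 * M))%:E).
  by rewrite lte_fin divr_gt0// mulr_gt0.
apply: le_ereal_inf_tmp => _ [l /lip h <-].
by rewrite lee_fin ler_pdivrMr ?mulr_gt0// mulrC.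
Qed.

(* Barth: the Kobayashi distance being an inner pseudodistance, a short chain
   leaving a ball yields a short chain ending on its boundary sphere, which is
   compact and hence at positive distance from the center. *)
Lemma kobayashi_hyperbolic_nbhs U p (A : set 'rV[C]_k) :
  open U -> kobayashi_hyperbolic U -> U p -> nbhs p A ->
  exists2 e : R, 0 < e & forall q l, kobayashi_chain U p q l -> l < e -> A q.
Proof.
move=> Uo hU Up pA.
have /nbhs_rnormP[r0 r00 r0U] : nbhs p (A `&` U).
  by apply: filterI => //; exact: open_nbhs_nbhs.
pose r := r0 / 2; have rgt : 0 < r by rewrite divr_gt0.
have rr0 : r < r0 by rewrite /r; lra.
have [e e0 eS] : exists2 e : R, 0 < e & forall s l, rnorm (s - p) = r ->
    kobayashi_chain U p s l -> e <= l.
  have nc := (compact_near_coveringP _).1 (@compact_rsphere R k p r).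
  have H : \forall e \near (0 : R)^'+, [set y : 'rV[C]_k | rnorm (y - p) = r]
      `<=` (fun s => forall l, kobayashi_chain U p s l -> e <= l).
    apply: (nc R (0 : R)^'+ (fun e s => forall l, kobayashi_chain U p s l -> e <= l)).
    move=> s /= sr; have Us : U s by apply: (r0U s _).2; rewrite sr.
    have ps : p <> s.
      by move=> ps; move: sr; rewrite ps subrr rnorm0 => /eqP; rewrite lt_eqF.
    have [d d0 hd] : exists2 d : R, 0 < d & forall l, kobayashi_chain U p s l -> d <= l.
      have := hU _ _ Up Us ps; have lb l : kobayashi_chain U p s l ->
          (kobayashi_dist U p s <= l%:E)%E.
        by move=> h; apply: ereal_inf_lbound; exists l.
      move: lb; case: (kobayashi_dist U p s) => [d| |] lb // d0.
      - by exists d => // l /lb; rewrite lee_fin.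
      (* At infinite distance no chain leads to [s], and any positive bound will do. *)
      - by exists 1 => // l /lb.
    (* A point joined to [s] by a chain shorter than [d / 2] cannot be reached from [p] by one that
       short; compactness makes the bound uniform on the sphere. *)
    have d20 : 0 < d / 2 by rewrite divr_gt0.
    near=> s' e => l hl.
    have [m md hm] : exists2 l, l < d / 2 & kobayashi_chain U s s' l.
      by near: s'; exact: chain_near.
    have /= := hd _ (chain_trans hl (chain_sym hm)).
    have : e < d / 2 by near: e; exact: nbhs_right_lt.
    by move=> /=; lra.
  near (0 : R)^'+ => e; exists e; first by near: e; exact: nbhs_right_gt.
  suff He : [set y : 'rV[C]_k | rnorm (y - p) = r]
      `<=` (fun s => forall l, kobayashi_chain U p s l -> e <= l).
    by move=> s l sr; exact: He.
  by near: e.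
(* The induction carries the length [l0] already spent from [p], so that every junction of the chain
   stays in the ball. *)
suff main q w l : kobayashi_chain U q w l -> forall l0,
    kobayashi_chain U p q l0 -> rnorm (q - p) < r -> l0 + l < e -> rnorm (w - p) < r.
  exists e => // w l h le; apply: (r0U w _).1; apply: lt_trans rr0.
  apply: (main _ _ _ h 0); rewrite ?add0r ?subrr ?rnorm0//; exact: chain_nil.
elim=> // phi a b x l' hphi a1 b1 hl' IH l0 hl0 ar le.
have hb := chain_trans hl0 (chain_disc hphi a1 b1).
apply: (IH _ hb) => //; last by rewrite -addrA.
have l'0 := chain_ge0 hl'.
have [psi [t [hpsi /andP[t0 t1] psi0 psit dt]]] := disc_normalize hphi a1 b1.
rewrite -psit ltNge; apply/negP => rt.
(* A disc ending outside the ball would cross the sphere at some [c <= t], at no greater cost than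
   the whole disc, against the choice of [e]. *)
have [||c] := @IVT R (fun s => rnorm (psi (rC s) - p)) 0 t r t0.
- apply: continuous_in_subspaceT => s; rewrite inE/= in_itv/= => /andP[s0 st].
  have sD : rnorm (rC s : C) < 1.
    by rewrite rnorm_rC ger0_norm//; apply: le_lt_trans t1.
  have cpsi : {for rC s, continuous psi}.
    by apply/differentiable_continuous/hpsi.1; rewrite unit_discE.
  apply/cvgrPdist_lt => d d0.
  have /nbhs_rnormP[d' d'0 hd'] :=
    cpsi _ ((nbhs_rnormP _ _).2 (ex_intro2 _ _ d d0 (fun y h => h))).
  apply/nbhs_normP; exists d' => //= y; rewrite /ball_/= distrC => ys.
  have := hd' (rC y); rewrite -rCB rnorm_rC => /(_ ys) /= h.
  have := ler_rdistD (psi (rC s)) (psi (rC y)) p.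
  have := ler_rdistD (psi (rC y)) (psi (rC s)) p.
  rewrite (rdistC (psi (rC s)) (psi (rC y))) => *.
  by rewrite ltr_distl; apply/andP; split; lra.
- rewrite rC0 psi0; apply/andP; split; first by rewrite ge_min (ltW ar).
  by rewrite le_max rt orbT.
rewrite in_itv/= => /andP[c0 ct] cr.
have c1 : c < 1 by exact: le_lt_trans t1.
have : kobayashi_chain U (phi a) (psi (rC c)) (disc_length c).
  rewrite -psi0 -poincare_dist0//; apply: chain_disc => //; rewrite unit_discE.
    by rewrite rnorm0.
  by rewrite rnorm_rC ger0_norm.
move=> /(chain_trans hl0)/(eS _ _ cr).
by have := disc_length_mono c0 ct t1; move: le; rewrite dt; lra.
Unshelve. all: by end_near. Qed.

End chains.

(** * Return times and compactness *)

Section minimality.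
Context {T : topologicalType}.
Implicit Types (V B A : set T) (f : T -> T).

Lemma iter_invariant V f n x : f @` V `<=` V -> V x -> V (iter n f x).
Proof. by move=> fV Vx; elim: n => //= n IH; apply: fV; exists (iter n f x). Qed.

Lemma iter_continuous V f n x : f @` V `<=` V ->
  (forall y, V y -> {for y, continuous f}) -> V x ->
  {for x, continuous (iter n f)}.
Proof.
move=> fV cf Vx; elim: n => [|n IH] /=; first exact: cvg_id.
apply: (@continuous_comp _ _ _ (iter n f) f); first exact: IH.
by apply: cf; exact: iter_invariant fV Vx.
Qed.

(* Return times to a compact neighbourhood B are bounded by some N, so an orbit
   starting in B stays in the union of the first N images of B. *)
Lemma minimal_locally_compact V f B (p : T) : hausdorff_space T ->
  f @` V `<=` V -> (forall y, V y -> {for y, continuous f}) ->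
  (forall (y z : T) A, V y -> V z -> nbhs z A -> exists n, A (iter n.+1 f y)) ->
  compact B -> B `<=` V -> nbhs p B -> compact V.
Proof.
move=> hT fV cf hmin cB BV pB.
have Bp : B p by exact: nbhs_singleton.
have Vp := BV _ Bp.
have [N HN] : exists N, forall y, B y -> exists2 i, (i < N)%N & B (iter i.+1 f y).
  have nc := (compact_near_coveringP _).1 cB.
  have H : \forall N \near \oo,
      B `<=` (fun y => exists2 i, (i < N)%N & B (iter i.+1 f y)).
    apply: (nc nat \oo (fun N y => exists2 i, (i < N)%N & B (iter i.+1 f y))).
    move=> y By; have [n Bn] := hmin _ _ _ (BV _ By) Vp (nbhs_interior pB).
    near=> y' M; exists n => /=.
      by near: M; exact: nbhs_infty_gt.
    by near: y'; exact: (iter_continuous (n := n.+1) fV cf (BV _ By) Bn).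
  by have [N _ /(_ N (leqnn N))] := H; exists N.
pose K : set T := \big[setU/set0]_(i < N.+1) (iter i f @` B).
have KP y : K y <-> exists i b, [/\ (i <= N)%N, B b & y = iter i f b].
  rewrite /K -(bigcup_mkord N.+1 (fun i => iter i f @` B)).
  split=> [[i /= iN [b Bb <-]]|[i [b [iN Bb ->]]]]; first by exists i, b.
  by exists i => //=; exists b.
have cK : compact K.
  apply: bigsetU_compact => i _; apply: continuous_compact => //.
  apply: continuous_in_subspaceT => y; rewrite inE => /BV Vy.
  exact: iter_continuous fV cf Vy.
have orbK n : K (iter n f p).
  apply/KP; elim: n => [|n [i [b [iN Bb e]]]]; first by exists 0%N, p.
  have [j jN Bj] := HN b Bb.
  move: iN; rewrite leq_eqVlt => /predU1P[iN|iN]; last first.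
    by exists i.+1, b; split=> //=; rewrite e.
  (* At [i = N] the orbit restarts from a return to [B]: [f^(N+1) b = f^(N-j) (f^(j+1) b)], with
     [j + 1 <= N]. *)
  exists (N - j)%N, (iter j.+1 f b); split=> //; first exact: leq_subr.
  by rewrite -iterD iterS e iN -iterS addnS subnK// ltnW.
suff -> : V = K by [].
apply/seteqP; split=> [y Vy|y /KP[i [b [_ /BV Vb ->]]]]; last exact: iter_invariant.
apply: contrapT => nKy.
have Ko : open (~` K) by apply: closed_openC; exact: compact_closed.
have [n] := hmin p y (~` K) Vp Vy (open_nbhs_nbhs (conj Ko nKy)).
by apply; exact: orbK.
Unshelve. all: by end_near. Qed.

End minimality.

(** * Dense orbits and a Baire argument in C^k *)

Section dynamics.
Context {R : realType} {k : nat} (i0 : 'I_k).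
Local Notation C := (Cplx R).
Implicit Types (U V E A : set 'rV[C]_k) (x y z : 'rV[C]_k).

Lemma exists_shift V y : open V -> V y -> exists2 z, z != y & V z.
Proof.
move=> Vo Vy; have /nbhs_rnormP[r r0 rV] : nbhs y V by exact: open_nbhs_nbhs.
have r20 : 0 < r / 2 by rewrite divr_gt0.
have [e er] := @exists_rnorm R k i0 (r / 2) (ltW r20).
exists (y + e); last by apply: rV; rewrite addrC addKr er; lra.
apply: contraTneq r20 => ye; have e0 : e = 0.
  by rewrite -(addKr y e) ye addNr.
by rewrite -er e0 rnorm0 ltxx.
Qed.

(** The real part of a coordinate would attain a maximum, which a small translation inside [V]
    increases. *)
Lemma compact_open_empty V : compact V -> open V -> V = set0.
Proof.
move=> cV Vo; apply/eqP/negPn/negP => /set0P V0.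
pose g (x : 'rV[C]_k) : R := complex.Re (x 0 i0).
have gB x y : `|g x - g y| <= rnorm (x - y).
  apply: le_trans (rnorm_coord (x - y) i0); rewrite !mxE.
  have -> : g x - g y = complex.Re (x 0 i0 - y 0 i0).
    by rewrite /g; case: (x 0 i0) => ? ?; case: (y 0 i0).
  exact: ler_Re.
have cg : continuous g.
  move=> x A /nbhs_normP[e e0 eA]; apply/nbhs_rnormP; exists e => // y yx.
  by apply: eA; rewrite /ball_/= distrC; exact: le_lt_trans yx.
have [c] := compact_EVT_max V0 cV (continuous_subspaceT cg).
rewrite inE => Vc cmax.
have /nbhs_rnormP[r r0 rV] : nbhs c V by exact: open_nbhs_nbhs.
pose e : 'rV[C]_k := \row_j rC (r / 2).
have r20 : 0 < r / 2 by rewrite divr_gt0.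
have er : rnorm e <= r / 2.
  by apply: rnorm_rV_le => [|j]; rewrite ?mxE ?rnorm_rC ?ger0_norm// ltW.
have Vce : V (c + e) by apply: rV; rewrite addrC addKr; lra.
have := cmax (c + e); rewrite inE => /(_ Vce).
have -> : g (c + e) = g c + r / 2.
  by rewrite /g !mxE /rC; case: (c 0 i0).
by lra.
Qed.

(** As [V] has no isolated point, the [N]-th iterate can be removed from [A] and a point of [V]
    still be interior to the rest; induction thus drops the first [N] iterates. *)
Lemma dense_orbit_tail V f x N y A : open V ->
  V `<=` closure (forward_orbit f x) -> V y -> nbhs y A ->
  exists2 n, (N <= n)%N & A (iter n f x).
Proof.
move=> Vo Vx; elim: N y A => [|N IH] y A Vy yA.
  have [_ [[n _ <-] An]] := Vx y Vy A yA.
  by exists n.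
have VA : open (V `&` A°) by apply: openI => //; exact: open_interior.
have [z zN [Vz Az]] : exists2 z, z != iter N f x & (V `&` A°) z.
  have [yN|yN] := eqVneq y (iter N f x); last by exists y => //; split.
  by rewrite -yN; apply: exists_shift => //; split.
pose a := iter N f x.
have aA : nbhs z (A `&` ~` [set w | rnorm (w - a) <= 0]).
  apply: filterI => //; apply: open_nbhs_nbhs; split.
    exact/closed_openC/closed_rball.
  move=> /= za; move/eqP: zN; apply; apply/subr0_eq/rnorm0_eq0.
  by apply/eqP; rewrite eq_le za rnorm_ge0.
have [n Nn [An na]] := IH _ _ Vz aA.
exists n => //; rewrite ltn_neqAle Nn andbT; apply: contra_notN na => /eqP <-.
by rewrite /a /= subrr rnorm0.
Qed.

Lemma chain_iter V f n x y l : holomorphic_on V f -> f @` V `<=` V ->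
  kobayashi_chain V x y l -> kobayashi_chain V (iter n f x) (iter n f y) l.
Proof. by move=> hf fV h; elim: n => //= n IH; exact: chain_map IH. Qed.

Lemma dense_orbit_empty_interior U f E : open U -> kobayashi_hyperbolic U ->
  holomorphic_on U f -> open_map_on U f ->
  closed_invariant_dense_orbit U f E -> E° = set0.
Proof.
move=> Uo hU hf fo [[EU _] fE [x Ex xE]].
apply: contrapT => /eqP/set0P[p pV].
set V := E° in pV *.
have Vo : open V by exact: open_interior.
have VE : V `<=` E by exact: interior_subset.
have VU := subset_trans VE EU.
have fV : f @` V `<=` V.
  have foV : open (f @` V) by exact: fo.
  rewrite -open_subsetE//; apply: subset_trans fE; exact: image_subset.
have hfV : holomorphic_on V f by move=> y /VU; exact: hf.
have cf y : V y -> {for y, continuous f}.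
  by move=> /hfV; exact: differentiable_continuous.
have dV : V `<=` closure (forward_orbit f x) by exact: subset_trans xE.
have hmin y z A : V y -> V z -> nbhs z A -> exists n, A (iter n.+1 f y).
  move=> Vy Vz zA.
  have [e e0 he] := kobayashi_hyperbolic_nbhs Uo hU (VU _ Vz) zA.
  have e20 : 0 < e / 2 by rewrite divr_gt0.
  have [m _ [a ae ya]] := dense_orbit_tail 0 Vo dV Vy (chain_near Vo Vy e20).
  have [n mn [b be zb]] := dense_orbit_tail m.+1 Vo dV Vz (chain_near Vo Vz e20).
  (* The time [n - m] is positive, and written as a successor to match [iter n.+1] in [hmin]. *)
  exists (n - m.+1)%N; apply: he (b + a) _ _; last lra.
  apply: (chain_sub VU); apply: chain_trans zb _; apply: chain_sym.
  have -> : iter n f x = iter (n - m.+1).+1 f (iter m f x).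
    by rewrite -iterD -subSn// subSS subnK// ltnW.
  exact: chain_iter.
have /nbhs_rnormP[r r0 rV] : nbhs p V by exact: open_nbhs_nbhs.
have r20 : 0 < r / 2 by rewrite divr_gt0.
have hT : hausdorff_space 'rV[C]_k by exact: norm_hausdorff.
have cV : compact V.
  apply: (minimal_locally_compact (p := p) hT fV cf hmin
    (@compact_rball R k p (r / 2))).
    by move=> y /= yp; apply: rV; apply: le_lt_trans yp _; lra.
  by apply/nbhs_rnormP; exists (r / 2) => // y /= /ltW.
by move: pV; rewrite (compact_open_empty cV Vo).
Qed.

(** Nested closed balls in [V], step [n] avoiding the set that the injection [h] numbers [n].
    Compactness of balls gives a common point, which no member of [F] contains. *)
Lemma baire_closed_in U V (F : set (set 'rV[C]_k)) : open V -> V !=set0 ->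
  V `<=` U -> countable F -> V `<=` \bigcup_(E in F) E ->
  (forall E, F E -> closed_in U E) -> exists2 E, F E & E° !=set0.
Proof.
move=> Vo [p Vp] VU /countable_injP[h hinj] VF Fcl.
apply: contrapT => nF.
have Fint E : F E -> E° = set0.
  move=> FE; apply/eqP/negPn/negP => /set0P E0; apply: nF; by exists E.
pose ball (b : 'rV[C]_k * R) : set 'rV[C]_k := [set y | rnorm (y - b.1) <= b.2].
have step (nb : nat * ('rV[C]_k * R)) : exists b', 0 < nb.2.2 -> ball nb.2 `<=` V ->
    [/\ 0 < b'.2, ball b' `<=` ball nb.2
      & forall E, F E -> h E = nb.1 -> ball b' `&` E = set0].
  case: nb => n [x r] /=.
  have [[r0 rV]|nr] := pselect (0 < r /\ ball (x, r) `<=` V); last first.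
    by exists (x, r) => r0 rV; exfalso; apply: nr.
  have [[E [FE hE]]|nE] := pselect (exists E, F E /\ h E = n); last first.
    (* No set has the number [n], and the ball is kept. *)
    exists (x, r) => _ _; split => // E FE hE; exfalso; apply: nE; by exists E.
  have [y yx nEy] : exists2 y, rnorm (y - x) < r & ~ E y.
    apply: contrapT => H.
    have : E° x.
      apply/nbhs_rnormP; exists r => // y yx; apply: contrapT => nEy.
      by apply: H; exists y.
    by rewrite Fint.
  have Vy : V y by apply: rV; rewrite /ball/= ltW.
  (* [E] is closed only relative to [U], but [y] lies in [U] and so avoids the full closure. *)
  have nE : nbhs y (~` closure E).
    apply: open_nbhs_nbhs; split; first exact/closed_openC/closed_closure.
    by move=> cEy; apply: nEy; rewrite -(Fcl _ FE).2; split => //; exact: VU.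
  have /nbhs_rnormP[s s0 sE] := nE.
  exists (y, Num.min (s / 2) (r - rnorm (y - x))) => _ _; split.
  - by rewrite lt_min divr_gt0//= subr_gt0.
  - move=> w; rewrite /ball/= le_min => /andP[_ wy].
    by have := ler_rdistD y w x; lra.
  - move=> E' FE' hE'; have -> : E' = E.
      by apply: hinj; rewrite ?inE// hE'.
    rewrite -subset0 => w [+ Ew]; rewrite /ball/= le_min => /andP[wy _].
    by apply: (sE w); [lra|exact: subset_closure].
have [G HG] := choice step.
have /nbhs_rnormP[r r0 rV] : nbhs p V by exact: open_nbhs_nbhs.
pose b := fix b n := if n is m.+1 then G (m, b m) else (p, r / 2).
have bP n : 0 < (b n).2 /\ ball (b n) `<=` V.
  elim: n => [|n [b0 bV]] /=.
    by split; [rewrite divr_gt0|move=> y; rewrite /ball/= => yp; apply: rV; lra].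
  by have [? bb _] := HG (n, b n) b0 bV; split => //; exact: subset_trans bV.
have bS n : ball (b n.+1) `<=` ball (b n) /\
    forall E, F E -> h E = n -> ball (b n.+1) `&` E = set0.
  by have [b0 bV] := bP n; have [] := HG (n, b n) b0 bV.
have bmono m n : (m <= n)%N -> ball (b n) `<=` ball (b m).
  move=> /subnKC <-; elim: (n - m)%N => [|i IH]; first by rewrite addn0.
  by rewrite addnS; apply: subset_trans IH; exact: (bS _).1.
have bc m n : (m <= n)%N -> ball (b m) (b n).1.
  move=> /bmono; apply; rewrite /ball/= subrr rnorm0; exact: ltW (bP n).1.
have [q [_ qcl]] : ball (b 0%N) `&` cluster ((fun n => (b n).1) @ \oo) !=set0.
  apply: compact_rball; exists 0%N => // n _; exact: bc.
have qb n : ball (b n) q.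
  have cl : closed (ball (b n)) by exact: closed_rball.
  apply: cl => A qA.
  have [] := qcl (ball (b n)) A _ qA; first by exists n => // m /= nm; exact: bc.
  by move=> w [? ?]; exists w.
have [E FE Eq] := VF q ((bP 0%N).2 _ (qb 0%N)).
have /seteqP[/(_ q) + _] := (bS (h E)).2 E FE erefl.
by apply; split => //; exact: qb.
Qed.

End dynamics.

Local Close Scope complex_scope.

Theorem corollary3p6 (R : realType) (k : nat) (hk : (0 < k)%N)
    (U : set 'rV[Cplx R]_k) (hUopen : open U) (hUconn : connected U)
    (hUhyp : bounded_set U \/ kobayashi_hyperbolic U)
    (f : 'rV[Cplx R]_k -> 'rV[Cplx R]_k)
    (hf : holomorphic_on U f) (hfopen : open_map_on U f)
    (hbarrier : forall q : 'rV[Cplx R]_k, boundary U q -> has_psh_barrier U q)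
    (C : set 'rV[Cplx R]_k) (hCU : C `<=` U) (hC : invariant_set f C)
    (V : set 'rV[Cplx R]_k) (hV : V = interior (closure_in U C))
    (hV0 : V !=set0)
    (W : set 'rV[Cplx R]_k) (hW : components V W)
    (p0 : 'rV[Cplx R]_k) (hWp0 : W p0) (hp0 : recurrent f V p0)
    (hdense : closed_invariant_dense_orbit U f (closure_in U C) \/
      exists F : set (set 'rV[Cplx R]_k),
        [/\ countable F,
            forall E, F E -> closed_invariant_dense_orbit U f E
          & closure_in U C = \bigcup_(E in F) E]) :
  forall p : 'rV[Cplx R]_k, ~ recurrent f V p.
Proof.
have hU : kobayashi_hyperbolic U.
  by case: hUhyp => // /bounded_kobayashi_hyperbolic.
have noint E : closed_invariant_dense_orbit U f E -> ~ (E° !=set0).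
  move=> hE; have := dense_orbit_empty_interior (Ordinal hk) hUopen hU hf hfopen hE.
  by move=> -> [].
(* In both cases the contradiction is with [hV0]: a nonempty [V] would give a closed invariant set
   with a dense orbit and nonempty interior. *)
move=> p _; case: hdense => [hE|[F [Fcount FE eF]]].
  by apply: (noint _ hE); rewrite -hV.
have VE : V `<=` \bigcup_(E in F) E.
  by rewrite -eF hV; exact: interior_subset.
have VU : V `<=` U.
  by rewrite hV => x /interior_subset[].
have Vo : open V by rewrite hV; exact: open_interior.
have Fcl E : F E -> closed_in U E by move=> /FE[].
have [E /FE hE] := baire_closed_in Vo hV0 VU Fcount VE Fcl.
exact: noint hE.
Qed.
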